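(* Let $F$ be a free group of arbitrary rank. Given a finitely generated subgroup $H$ of $F$, it is decidable whether or not $H$ is $\mathbf{Su}$-dense in $F$.
   Context: A finite group is supersolvable if all of its chief factors are cyclic (of prime order). $\mathbf{Su}$ denotes the class (pseudovariety) of all finite supersolvable groups. The group $F$ is endowed with the pro-$\mathbf{Su}$ topology, in which the normal subgroups $K$ of $F$ with $F/K\in\mathbf{Su}$ form a basis of neighbourhoods of the identity. A subgroup $H$ of $F$ is $\mathbf{Su}$-dense if it is dense in this topology; equivalently, $HN=F$ for every normal subgroup $N$ of $F$ with $F/N\in\mathbf{Su}$. The group $F$ is given with a basis $X$, and $H$ is given by a finite list of reduced words over $X\cup X^{-1}$ generating it. ''Decidable'' means that there is an algorithm which, on such an input, determines whether $H$ is $\mathbf{Su}$-dense in $F$. *)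

(* Defs.v *)
From mathcomp Require Import all_boot all_fingroup all_solvable.

Set Implicit Arguments.
Unset Strict Implicit.
Unset Printing Implicit Defensive.

Local Open Scope group_scope.

(* The total recursive functions nat^n -> nat: the least class of functions
   containing zero, successor and projections that is closed under composition,
   primitive recursion and minimization of regular functions, i.e. those f for
   which every v admits a k with f (k, v) = 0. *)
Inductive recursive : forall n, (n.-tuple nat -> nat) -> Prop :=
| rec_zero n : @recursive n (fun=> 0%N)
| rec_succ : @recursive 1 (fun v => (thead v).+1)
| rec_proj n (i : 'I_n) : @recursive n (fun v => tnth v i)
| rec_comp m n (f : m.-tuple nat -> nat) (g : 'I_m -> n.-tuple nat -> nat)
    (h : n.-tuple nat -> nat) of
    recursive f & (forall i, recursive (g i))
    & (forall v, h v = f [tuple g i v | i < m]) : recursive h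
| rec_prim n (f : n.-tuple nat -> nat) (g : n.+2.-tuple nat -> nat)
    (h : n.+1.-tuple nat -> nat) of
    recursive f & recursive g
    & (forall v : n.-tuple nat, h [tuple of 0%N :: v] = f v)
    & (forall k (v : n.-tuple nat),
        h [tuple of k.+1 :: v] = g [tuple of k :: h [tuple of k :: v] :: v]) :
    recursive h
| rec_min n (f : n.+1.-tuple nat -> nat) (h : n.-tuple nat -> nat) of
    recursive f
    & (forall v : n.-tuple nat, f [tuple of h v :: v] = 0%N)
    & (forall (v : n.-tuple nat) k,
        (k < h v)%N -> f [tuple of k :: v] <> 0%N) : recursive h.

Definition free_basis (X : Type) (F : groupType) (b : X -> F) : Prop :=
  forall (G : groupType) (f : X -> G),
    (exists phi : {multiplicative F -> G}, forall x, phi (b x) = f x) /\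
    (forall phi psi : {multiplicative F -> G},
       (forall x, phi (b x) = f x) -> (forall x, psi (b x) = f x) ->
       forall g, phi g = psi g).

(* Some n stands for the finite rank n, None for any infinite rank. *)
Definition has_rank (X : eqType) (r : option nat) : Prop :=
  if r is Some n then exists e : 'I_n -> X, bijective e
  else forall s : seq X, exists x, x \notin s.

(* The pair (x, false) is the letter x, and (x, true) the letter x^-1. *)
Definition word (X : Type) := seq (X * bool).

Definition reduced (X : eqType) (w : word X) : bool :=
  sorted (fun a c => ~~ ((a.1 == c.1) && (a.2 != c.2))) w.

Definition eval_word (X : Type) (F : groupType) (b : X -> F) (w : word X) : F :=
  \prod_(a <- w) (if a.2 then (b a.1)^-1 else b a.1).

Definition letters (X : Type) (ws : seq (word X)) : seq X :=
  [seq a.1 | a <- flatten ws].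

Inductive subgroup_gen (F : groupType) (S : F -> Prop) : F -> Prop :=
| gen_in g of S g : subgroup_gen S g
| gen_one : subgroup_gen S 1
| gen_mul g h of subgroup_gen S g & subgroup_gen S h : subgroup_gen S (g * h)
| gen_inv g of subgroup_gen S g : subgroup_gen S g^-1.

Definition supersolvable (gT : finGroupType) (G : {group gT}) : Prop :=
  forall V U : {group gT}, chief_factor G V U -> cyclic (U / V).

(* N is a normal subgroup of F with F / N finite and supersolvable: the quotient
   map is presented as an epimorphism onto a finite group with kernel N. *)
Definition Su_conormal (F : groupType) (N : F -> Prop) : Prop :=
  exists (Q : finGroupType) (pi : {multiplicative F -> Q}),
    [/\ forall q, exists g, pi g = q,
        forall g, N g <-> pi g = 1
      & supersolvable [set: Q]%G].

Definition pro_Su_open (F : groupType) (U : F -> Prop) : Prop :=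
  forall g, U g -> exists2 N, Su_conormal N & forall n, N n -> U (g * n).

Definition Su_dense (F : groupType) (H : F -> Prop) : Prop :=
  forall U : F -> Prop, pro_Su_open U -> (exists g, U g) ->
  exists2 h, H h & U h.

Lemma Su_denseP (F : groupType) (H : F -> Prop) :
  Su_dense H <->
  (forall N, Su_conormal N -> forall g, exists h n, [/\ H h, N n & g = h * n]).
Proof.
split=> [dH N SuN g | HNF U openU [g Ug]].
  have [Q [pi [_ NE _]]] := SuN.
  have pi1 : pi 1 = 1 by apply: (mulgI (pi 1)); rewrite -gmulfM !mulg1.
  have piV x : pi x^-1 = (pi x)^-1.
    by apply: (mulgI (pi x)); rewrite -gmulfM !mulgV pi1.
  have [||h Hh /NE Nh] := dH (fun x => N (x^-1 * g)).
  - move=> x /NE Nx; exists N => // n /NE Nn; apply/NE.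
    by rewrite invgM -mulgA gmulfM Nx mulg1 piV Nn invg1.
  - by exists g; apply/NE; rewrite mulVg.
  by exists h, (h^-1 * g); split; [| apply/NE | rewrite mulVKg].
have [N SuN NU] := openU _ Ug; have [Q [pi [_ NE _]]] := SuN.
have pi1 : pi 1 = 1 by apply: (mulgI (pi 1)); rewrite -gmulfM !mulg1.
have piV x : pi x^-1 = (pi x)^-1.
  by apply: (mulgI (pi x)); rewrite -gmulfM !mulgV pi1.
have [h [n [Hh /NE Nn gE]]] := HNF _ SuN g; exists h => //.
have -> : h = g * n^-1 by rewrite gE mulgK.
by apply/NU/NE; rewrite piV Nn invg1.
Qed.

(* Basis elements reach an algorithm through an arbitrary naming lab by natural
   numbers; the names are encoded with the sign in the lowest bit.  The function
   CodeSeq.code is the bijective Goedel numbering of seq nat, with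
   code [::] = 0 and code (n :: s) = 2 ^ n * (2 * code s + 1). *)
Definition word_code (X : Type) (lab : X -> nat) (w : word X) : nat :=
  CodeSeq.code [seq ((lab a.1).*2 + a.2)%N | a : X * bool <- w].

Definition rank_code (r : option nat) : nat := if r is Some n then n.+1 else 0%N.

Definition input_code (X : Type) (r : option nat) (lab : X -> nat)
    (ws : seq (word X)) : nat :=
  CodeSeq.code (rank_code r :: [seq word_code lab w | w <- ws]).

Definition decides_at (f : 1.-tuple nat -> nat) (c : nat) (P : Prop) : Prop :=
  (P -> f [tuple c] = 1%N) /\ (~ P -> f [tuple c] = 0%N).

(* Main.v *)
(* H fails to be Su-dense iff, for some prime p, there is a homomorphism from F to the
   affine group of 'F_p under which H fixes 0 and F does not.  Such a homomorphism
   kills density since subgroups of the affine group are supersolvable.  Conversely,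
   if H has a proper image K in a supersolvable group G, take N maximal among the
   normal subgroups with K N <> G and U / N a chief factor: then G = K U, U / N has
   prime order p, and G acts by affine maps on the cosets of K N.

   Sending the letter x to t |-> u_x t + a_x with a_x0 = 1 for one letter x0, such
   homomorphisms are the 'F_p-points of a finite system of integral polynomial
   equations.  If the ideal of the system contains no positive integer then there is
   a point over some 'F_p: a prime ideal of characteristic 0 specializes to a point
   over Q(z) for some algebraic number z, whose minimal polynomial has roots modulo
   infinitely many primes.  Otherwise an
   integer N > 0 in the ideal bounds the possible characteristics.  Hence the search
   for either a point or an expression of such an N terminates. *)
From HB Require Import structures.
Require Import Defs.
From mathcomp Require Import all_boot all_order all_fingroup all_solvable.
From mathcomp Require Import all_algebra all_field.
From mathcomp Require classical_sets.
From mathcomp Require Import boolp zify.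

Set Implicit Arguments.
Unset Strict Implicit.
Unset Printing Implicit Defensive.
Import CodeSeq.

(** * Closure properties of recursive functions *)

(** Zorn's lemma, excluded middle and algebraic numbers only show that the search stops; the
    procedure itself is an explicit recursive function of one natural number, so all its data must
    be handled by arithmetic on codes. To avoid polynomial arithmetic, a monomial is a positive
    integer, and an auxiliary unknown z_w is introduced for each word w. Every equation then has at
    most two monomials on each side, all with coefficient 1, and membership in the ideal becomes a
    list of signed monomial multiples of equations, verified by counting.

    That F moves 0 is an inequation: some letter has a nonzero translation part. Rescaling the line
    makes this part 1, which turns the inequation into an equation for each candidate x0. Only
    finitely many candidates remain, because a basis letter absent from the words already excludes
    density; a dense H therefore requires finite rank equal to the number of distinct labels. *)

Lemma recursive_ext n (f h : n.-tuple nat -> nat) :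
  recursive f -> f =1 h -> recursive h.
Proof.
move=> recf eqfh; apply: (rec_comp recf (fun i => rec_proj i)) => v.
by rewrite -eqfh; congr f; apply: eq_from_tnth => i; rewrite tnth_mktuple.
Qed.

Lemma recursive_app n m (f : m.-tuple nat -> nat) (g : 'I_m -> n.-tuple nat -> nat) :
  recursive f -> (forall i, recursive (g i)) ->
  recursive (fun v => f [tuple g i v | i < m]).
Proof. by move=> recf recg; apply: (rec_comp recf recg). Qed.

Lemma recursive_thead n : recursive (fun w : n.+1.-tuple nat => thead w).
Proof. exact: rec_proj. Qed.

Lemma recursive_behead n (f : n.-tuple nat -> nat) :
  recursive f -> recursive (fun w : n.+1.-tuple nat => f (behead_tuple w)).
Proof.
move=> recf; apply: recursive_ext (recursive_app recf (fun i => rec_proj (lift ord0 i))) _ => w.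
congr f; apply: eq_from_tnth => i; rewrite tnth_mktuple tnth_behead; congr tnth.
by apply: val_inj; rewrite /= inordK // ltnS.
Qed.

Lemma recursive_behead2 n (f : n.-tuple nat -> nat) :
  recursive f ->
  recursive (fun w : n.+2.-tuple nat => f (behead_tuple (behead_tuple w))).
Proof. by move=> /recursive_behead/recursive_behead. Qed.

Lemma recursive_second n : recursive (fun w : n.+2.-tuple nat => thead (behead_tuple w)).
Proof. exact: (recursive_behead (recursive_thead n)). Qed.

Lemma recursive_succ n (f : n.-tuple nat -> nat) :
  recursive f -> recursive (fun v => (f v).+1).
Proof.
move=> recf; apply: recursive_ext (recursive_app rec_succ (fun=> recf)) _ => v.
by rewrite /thead tnth_mktuple.
Qed.

Lemma recursive_const n k : recursive (fun _ : n.-tuple nat => k).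
Proof. by elim: k => [|k IHk]; [apply: rec_zero | apply: recursive_succ]. Qed.

(** Primitive recursion as a loop, with counter, accumulator and parameters as the entries of one
    tuple; the bounded loops below reduce to it. *)
Lemma recursive_iteri n (b a : n.-tuple nat -> nat) (s : nat -> nat -> n.-tuple nat -> nat) :
  recursive b -> recursive a ->
  recursive (fun w : n.+2.-tuple nat =>
    s (thead w) (thead (behead_tuple w)) (behead_tuple (behead_tuple w))) ->
  recursive (fun v => iteri (b v) (fun k x => s k x v) (a v)).
Proof.
move=> recb reca recs.
pose h (w : n.+1.-tuple nat) :=
  iteri (thead w) (fun k x => s k x (behead_tuple w)) (a (behead_tuple w)).
have rech : recursive h.
  apply: (rec_prim reca recs) => [v|k v]; rewrite /h ?theadE.
    by congr a; apply: val_inj.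
  have behK (x : nat) : behead_tuple [tuple of x :: v] = v by apply: val_inj.
  rewrite behK; congr s; last exact/esym/val_inj.
  by transitivity (h [tuple of k :: v]); rewrite // /h theadE behK.
have recb' : forall i : 'I_n.+1, recursive (fun v => tnth [tuple of b v :: v] i).
  move=> i; case: (unliftP ord0 i) => [j|] ->.
    by apply: recursive_ext (rec_proj j) _ => v; rewrite tnthS.
  by apply: recursive_ext recb _ => v; rewrite tnth0.
apply: recursive_ext (recursive_app rech recb') _ => v; rewrite /h.
have -> : [tuple tnth [tuple of b v :: v] i | i < n.+1] = [tuple of b v :: v].
  by apply: eq_from_tnth => i; rewrite tnth_mktuple.
by rewrite theadE; have -> : behead_tuple [tuple of b v :: v] = v by apply: val_inj.
Qed.

Create HintDb rec.
#[local] Hint Resolve rec_proj recursive_thead recursive_second recursive_const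
  recursive_behead recursive_behead2 recursive_succ : rec.

Section Arithmetic.
Variable n : nat.
Implicit Types f g h : n.-tuple nat -> nat.
Implicit Types P Q : n.-tuple nat -> bool.

Lemma recursive_add f g :
  recursive f -> recursive g -> recursive (fun v => f v + g v).
Proof.
move=> rf rg.
apply: recursive_ext (recursive_iteri rf rg (s := fun _ x _ => x.+1) _) _; auto with rec.
by move=> v; elim: (f v) => //= k ->; rewrite addSn.
Qed.

Lemma recursive_pred f : recursive f -> recursive (fun v => (f v).-1).
Proof.
move=> rf.
apply: recursive_ext (recursive_iteri rf (rec_zero n) (s := fun k _ _ => k) _) _; auto with rec.
by move=> v; case: (f v).
Qed.
End Arithmetic.
#[local] Hint Resolve recursive_add recursive_pred : rec.

Section Arithmetic2.
Variable n : nat.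
Implicit Types f g h : n.-tuple nat -> nat.
Implicit Types P Q : n.-tuple nat -> bool.

Lemma recursive_sub f g :
  recursive f -> recursive g -> recursive (fun v => f v - g v).
Proof.
move=> rf rg.
apply: recursive_ext (recursive_iteri rg rf (s := fun _ x _ => x.-1) _) _; auto with rec.
by move=> v; elim: (g v) => [|k IHk] /=; rewrite ?subn0 // IHk subnS.
Qed.

Lemma recursive_mul f g :
  recursive f -> recursive g -> recursive (fun v => f v * g v).
Proof.
move=> rf rg; apply: recursive_ext (recursive_iteri rf (rec_zero n)
  (s := fun _ x v => g v + x) _) _; auto with rec.
by move=> v; elim: (f v) => //= k ->; rewrite mulSn.
Qed.

End Arithmetic2.
#[local] Hint Resolve recursive_sub recursive_mul : rec.

Section Logic.
Variable n : nat.
Implicit Types f g h : n.-tuple nat -> nat.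
Implicit Types P Q : n.-tuple nat -> bool.

Lemma recursive_exp f g :
  recursive f -> recursive g -> recursive (fun v => f v ^ g v).
Proof.
move=> rf rg; apply: recursive_ext (recursive_iteri rg (recursive_const n 1)
  (s := fun _ x v => f v * x) _) _; auto with rec.
by move=> v; elim: (g v) => //= k ->; rewrite expnS.
Qed.

Lemma recursive_neg P : recursive P -> recursive (fun v => ~~ P v).
Proof.
move=> rP; apply: recursive_ext (recursive_sub (recursive_const n 1) rP) _ => v.
by case: (P v).
Qed.

Lemma recursive_and P Q : recursive P -> recursive Q -> recursive (fun v => P v && Q v).
Proof.
by move=> rP rQ; apply: recursive_ext (recursive_mul rP rQ) _ => v; rewrite mulnb.
Qed.

Lemma recursive_or P Q : recursive P -> recursive Q -> recursive (fun v => P v || Q v).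
Proof.
move=> rP rQ; have := recursive_neg (recursive_and (recursive_neg rP) (recursive_neg rQ)).
by move/recursive_ext; apply=> v; case: (P v); case: (Q v).
Qed.

Lemma recursive_if P f g : recursive P -> recursive f -> recursive g ->
  recursive (fun v => if P v then f v else g v).
Proof.
move=> rP rf rg; apply: (recursive_ext (f := fun v => P v * f v + ~~ P v * g v)).
  by apply: recursive_add; apply: recursive_mul => //; apply: recursive_neg.
by move=> v; case: (P v); rewrite !(mul1n, mul0n) ?addn0.
Qed.

Lemma recursive_odd f : recursive f -> recursive (fun v => odd (f v)).
Proof.
move=> rf; apply: recursive_ext (recursive_iteri rf (rec_zero n)
  (s := fun _ x v => 1 - x) _) _; auto with rec.
by move=> v; elim: (f v) => //= k ->; case: odd.
Qed.

Lemma recursive_leq f g : recursive f -> recursive g -> recursive (fun v => f v <= g v).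
Proof.
move=> rf rg; have := recursive_sub (recursive_const n 1) (recursive_sub rf rg).
by move/recursive_ext; apply=> v; rewrite /leq; case: (f v - g v) => // k; rewrite subSS sub0n.
Qed.

Lemma recursive_eq f g : recursive f -> recursive g -> recursive (fun v => f v == g v).
Proof.
move=> rf rg; have := recursive_and (recursive_leq rf rg) (recursive_leq rg rf).
by move/recursive_ext; apply=> v; rewrite eqn_leq.
Qed.

Lemma recursive_sum f (F : nat -> n.-tuple nat -> nat) : recursive f ->
  recursive (fun w : n.+1.-tuple nat => F (thead w) (behead_tuple w)) ->
  recursive (fun v => \sum_(i < f v) F i v).
Proof.
move=> rf rF.
apply: recursive_ext (recursive_iteri rf (rec_zero n) (s := fun k x v => x + F k v) _) _.
  apply: recursive_add; first exact: recursive_second.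
  (* [g] drops the accumulator from the tuple, so that [F] sees only the counter and the
     parameters. *)
  pose g (i : 'I_n.+1) (w : n.+2.-tuple nat) :=
    if unlift ord0 i is Some j then tnth (behead_tuple (behead_tuple w)) j else thead w.
  have rg i : recursive (g i).
    rewrite /g; case: (unlift ord0 i) => [j|]; last exact: rec_proj.
    exact: (recursive_behead2 (f := fun v : n.-tuple nat => tnth v j) (rec_proj j)).
  apply: recursive_ext (recursive_app rF rg) _ => w.
  congr F; first by rewrite /thead tnth_mktuple /g unlift_none.
  apply: eq_from_tnth => i; rewrite tnth_behead tnth_mktuple /g.
  have -> : inord i.+1 = lift ord0 i by apply: val_inj; rewrite /= inordK // ltnS.
  by rewrite liftK.
by move=> v; elim: (f v) => [|k IHk]; rewrite ?big_ord0 ?big_ord_recr //= IHk.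
Qed.

End Logic.
#[local] Hint Resolve recursive_exp recursive_neg recursive_and recursive_or
  recursive_if recursive_odd recursive_leq recursive_eq recursive_sum : rec.

Section Bounded.
Variable n : nat.
Implicit Types f g h : n.-tuple nat -> nat.

Lemma recursive_all_iota f (P : nat -> n.-tuple nat -> bool) : recursive f ->
  recursive (fun w : n.+1.-tuple nat => P (thead w) (behead_tuple w)) ->
  recursive (fun v => all (P^~ v) (iota 0 (f v))).
Proof.
move=> rf rP; have := recursive_sum rf (F := fun i v => ~~ P i v) (recursive_neg rP).
move=> rS; apply: recursive_ext (recursive_eq rS (rec_zero n)) _ => v.
rewrite sum_nat_eq0; congr nat_of_bool; apply/forallP/allP => [allP i|allP i].
  by rewrite mem_iota add0n => lti; have := allP (Ordinal lti); rewrite eqb0 negbK.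
by rewrite /= eqb0 negbK allP // mem_iota add0n ltn_ord.
Qed.

Lemma recursive_has_iota f (P : nat -> n.-tuple nat -> bool) : recursive f ->
  recursive (fun w : n.+1.-tuple nat => P (thead w) (behead_tuple w)) ->
  recursive (fun v => has (P^~ v) (iota 0 (f v))).
Proof.
move=> rf rP.
have := recursive_neg (recursive_all_iota rf (P := fun i v => ~~ P i v) (recursive_neg rP)).
move/recursive_ext; apply=> v; rewrite -has_predC; congr nat_of_bool.
by apply: eq_has => i /=; rewrite negbK.
Qed.
End Bounded.
#[local] Hint Resolve recursive_all_iota recursive_has_iota : rec.

Section Division.
Variable n : nat.
Implicit Types f g h : n.-tuple nat -> nat.

Lemma recursive_div f g : recursive f -> recursive g -> recursive (fun v => f v %/ g v).
Proof.
move=> rf rg.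
(* The quotient is the number of positive multiples of [g v] not exceeding [f v]. *)
apply: (recursive_ext (f := fun v => if g v == 0 then 0 else \sum_(i < f v) (i.+1 * g v <= f v))).
  apply: recursive_if; [auto with rec.. | ].
  by apply: (recursive_sum (F := fun i v => i.+1 * g v <= f v)); auto 10 with rec.
move=> v; case: eqP => [->|/eqP]; rewrite ?divn0 // -lt0n; move: (f v) (g v) => m d d0.
rewrite (eq_bigr (fun i : 'I_m => (i < m %/ d : nat))) => [|i _]; last by rewrite leq_divRL.
have sum_lt q k : \sum_(i < k) (i < q) = minn q k.
  by elim: k => [|k IHk]; rewrite ?big_ord0 ?big_ord_recr /= ?IHk; lia.
by rewrite sum_lt; apply/minn_idPl/leq_div.
Qed.

Lemma recursive_mod f g : recursive f -> recursive g -> recursive (fun v => f v %% g v).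
Proof.
move=> rf rg; apply: (recursive_ext (f := fun v => f v - f v %/ g v * g v)).
  by have := recursive_div rf rg; auto with rec.
by move=> v; rewrite {1}(divn_eq (f v) (g v)) addKn.
Qed.

Lemma recursive_dvd f g : recursive f -> recursive g -> recursive (fun v => f v %| g v).
Proof.
by move=> rf rg; apply: (recursive_eq (recursive_mod rg rf) (rec_zero n)).
Qed.
End Division.
#[local] Hint Resolve recursive_div recursive_mod recursive_dvd : rec.

Lemma recursive_find n (P : nat -> n.-tuple nat -> bool) (h : n.-tuple nat -> nat) :
  recursive (fun w : n.+1.-tuple nat => P (thead w) (behead_tuple w)) ->
  (forall v, P (h v) v) -> (forall v k, k < h v -> ~~ P k v) -> recursive h.
Proof.
move=> /recursive_neg rP Ph minh; apply: (rec_min rP) => [v|v k ltkh].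
  have -> : behead_tuple [tuple of h v :: v] = v by apply: val_inj.
  by rewrite theadE Ph.
have -> : behead_tuple [tuple of k :: v] = v by apply: val_inj.
by rewrite theadE minh.
Qed.

(** * Lists coded by numbers *)

Section Lists.
Variable n : nat.
Implicit Types f g h : n.-tuple nat -> nat.

(* Head and tail of the list coded by c; both are 0 if the list is empty. *)
Definition hd c := head 0 (decode c).
Definition tl c := code (behead (decode c)).

Lemma decodeE c : decode c = if c == 0 then [::] else hd c :: decode (tl c).
Proof. by rewrite /hd /tl codeK; case: c => // c; case: (decode c.+1) (decodeK c.+1). Qed.

Lemma code_cons c : 0 < c -> c = 2 ^ hd c * (tl c).*2.+1.
Proof.
move=> c0; rewrite -{1}[c]decodeK decodeE eqn0Ngt c0 /=; congr (_ * (_).*2.+1).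
by rewrite decodeK.
Qed.

Lemma hdE c : hd c = logn 2 c.
Proof.
case: c => // c; rewrite {2}(code_cons (ltn0Sn c)) lognM ?expn_gt0 // pfactorK //.
by rewrite [logn 2 _]logn_coprime ?addn0 // coprime2n /= odd_double.
Qed.

Lemma tlE c : tl c = (c %/ 2 ^ hd c)./2.
Proof.
case: c => // c; rewrite {2}(code_cons (ltn0Sn c)) mulKn ?expn_gt0 //=.
by rewrite uphalf_double.
Qed.

Lemma recursive_hd f : recursive f -> recursive (fun v => hd (f v)).
Proof.
(* The head is the 2-adic valuation of the code c; the sum may stop at exponent c because 2 ^ c >
   c. *)
move=> rf; apply: (recursive_ext (f := fun v => \sum_(i < f v) (2 ^ i.+1 %| f v))).
  by apply: (recursive_sum (F := fun i v => 2 ^ i.+1 %| f v)); auto 10 with rec.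
move=> v; rewrite hdE logn_count_dvd //; case: (f v) => [|c]; first by rewrite big_ord0 big_geq.
rewrite big_add1 /= big_mkord big_ord_recr /= [_ %| _]gtnNdvd ?addn0 //.
exact: ltn_expl.
Qed.

Lemma recursive_tl f : recursive f -> recursive (fun v => tl (f v)).
Proof.
move=> rf; apply: (recursive_ext (f := fun v => f v %/ 2 ^ hd (f v) %/ 2)).
  by have := recursive_hd rf; auto with rec.
by move=> v; rewrite tlE divn2.
Qed.
End Lists.
#[local] Hint Resolve recursive_hd recursive_tl : rec.

Lemma recursive_iter_tl n (f g : n.-tuple nat -> nat) :
  recursive f -> recursive g -> recursive (fun v => iter (f v) tl (g v)).
Proof.
move=> rf rg.
by apply: recursive_ext (recursive_iteri rf rg (s := fun _ x _ => tl x) _) _; auto with rec.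
Qed.

Section Folds.
Variable n : nat.
Implicit Types f g h : n.-tuple nat -> nat.

Lemma decode_iter_tl k c : decode (iter k tl c) = drop k (decode c).
Proof.
elim: k => [|k IHk] /=; first by rewrite drop0.
by rewrite /tl codeK IHk -drop1 drop_drop add1n.
Qed.

Lemma size_decode c : size (decode c) <= c.
Proof.
rewrite -{2}[c]decodeK; elim: (decode c) => //= x s IHs.
by rewrite (leq_trans (_ : _ <= (code s).*2.+1)) ?ltnS ?leq_pmull ?expn_gt0 // -addnn; lia.
Qed.

Lemma recursive_env m k (f : k.-tuple nat -> nat) (e : m.-tuple nat -> k.-tuple nat) :
  recursive f -> (forall i, recursive (fun v => tnth (e v) i)) ->
  recursive (fun v => f (e v)).
Proof.
move=> rf re; apply: recursive_ext (recursive_app rf re) _ => v.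
by congr f; apply: eq_from_tnth => i; rewrite tnth_mktuple.
Qed.

Lemma recursive_env_cons m k (a : m.-tuple nat -> nat) (e : m.-tuple nat -> k.-tuple nat) :
  recursive a -> (forall i, recursive (fun v => tnth (e v) i)) ->
  forall i, recursive (fun v => tnth [tuple of a v :: e v] i).
Proof.
move=> ra re i; case: (unliftP ord0 i) => [j|] ->.
  by apply: recursive_ext (re j) _ => v; rewrite tnthS.
by apply: recursive_ext ra _ => v; rewrite tnth0.
Qed.

(** The loop consumes the list from its end, step k treating position [f v - k.+1]. A list is no
    longer than its code, so [f v] steps suffice, and the steps that fall beyond the end leave the
    accumulator unchanged. *)
Lemma recursive_foldr f g (s : nat -> nat -> n.-tuple nat -> nat) :
  recursive f -> recursive g ->
  recursive (fun w : n.+2.-tuple nat =>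
    s (thead w) (thead (behead_tuple w)) (behead_tuple (behead_tuple w))) ->
  recursive (fun v => foldr (fun x y => s x y v) (g v) (decode (f v))).
Proof.
move=> rf rg rs.
pose rest k (v : n.-tuple nat) := iter (f v - k.+1) tl (f v).
apply: recursive_ext (recursive_iteri rf rg (s := fun k y v =>
  if rest k v == 0 then y else s (hd (rest k v)) y v) _) _.
  have rrest : recursive (fun w : n.+2.-tuple nat =>
      rest (thead w) (behead_tuple (behead_tuple w))).
    by rewrite /rest; apply: recursive_iter_tl; auto with rec.
  apply: recursive_if; [auto with rec.. | ].
  have re i : recursive (fun w : n.+2.-tuple nat => tnth (behead_tuple (behead_tuple w)) i).
    exact: (recursive_behead2 (f := fun v : n.-tuple nat => tnth v i) (rec_proj i)).
  have := recursive_env rs (recursive_env_cons (recursive_hd rrest)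
    (recursive_env_cons (recursive_second n) re)).
  move/recursive_ext; apply=> w; rewrite !theadE.
  by congr s; apply: val_inj.
move=> v.
have iterE k : k <= f v -> iteri k (fun k y =>
    if rest k v == 0 then y else s (hd (rest k v)) y v) (g v) =
    foldr (fun x y => s x y v) (g v) (drop (f v - k) (decode (f v))).
  elim: k => [|k IHk] lek; first by rewrite subn0 drop_oversize ?size_decode.
  rewrite /= IHk ?(ltnW lek) //.
  rewrite -!decode_iter_tl -(subnSK lek) iterS -/(rest k v).
  rewrite [in RHS]decodeE; case: eqP => [->|_] //.
by rewrite iterE // subnn drop0.
Qed.

Lemma recursive_all_decode f (P : nat -> n.-tuple nat -> bool) : recursive f ->
  recursive (fun w : n.+1.-tuple nat => P (thead w) (behead_tuple w)) ->
  recursive (fun v => all (P^~ v) (decode (f v))).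
Proof.
move=> rf rP.
apply: recursive_ext (recursive_foldr rf (recursive_const n 1)
  (s := fun x y v => P x v * y) _) _.
  apply: recursive_mul; last exact: recursive_second.
  have re i : recursive (fun w : n.+2.-tuple nat => tnth (behead_tuple (behead_tuple w)) i).
    exact: (recursive_behead2 (f := fun v : n.-tuple nat => tnth v i) (rec_proj i)).
  have := recursive_env rP (recursive_env_cons (recursive_thead n.+1) re).
  by move/recursive_ext; apply=> w; rewrite theadE; congr P; apply: val_inj.
by move=> v; elim: (decode (f v)) => //= x s ->; rewrite mulnb.
Qed.

Lemma recursive_has_decode f (P : nat -> n.-tuple nat -> bool) : recursive f ->
  recursive (fun w : n.+1.-tuple nat => P (thead w) (behead_tuple w)) ->
  recursive (fun v => has (P^~ v) (decode (f v))).
Proof.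
move=> rf rP.
have := recursive_neg (recursive_all_decode rf (P := fun i v => ~~ P i v) (recursive_neg rP)).
move/recursive_ext; apply=> v; rewrite -has_predC; congr nat_of_bool.
by apply: eq_has => i /=; rewrite negbK.
Qed.
End Folds.
#[local] Hint Resolve recursive_hd recursive_tl recursive_iter_tl
  recursive_all_decode recursive_has_decode recursive_foldr : rec.

(** * The decision procedure *)

Lemma recursive_half n (f : n.-tuple nat -> nat) :
  recursive f -> recursive (fun v => (f v)./2).
Proof.
move=> rf; apply: (recursive_ext (f := fun v => f v %/ 2)); auto with rec.
by move=> v; rewrite divn2.
Qed.

Lemma recursive_prime n (f : n.-tuple nat -> nat) :
  recursive f -> recursive (fun v => prime (f v)).
Proof.
move=> rf; apply: (recursive_ext (f := fun v => (1 < f v) &&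
  all (fun d => ~~ (d %| f v) || ((d == 1) || (d == f v))) (iota 0 (f v).+1))).
  by auto 10 with rec.
move=> v; congr nat_of_bool; apply/andP/primeP => -[p_gt1 pP]; split=> //.
  move=> d dv; have /allP/(_ d) := pP.
  by rewrite mem_iota add0n ltnS (dvdn_leq (ltnW p_gt1) dv) dv => /(_ isT).
by apply/allP => d _; case: (boolP (d %| f v)) => //= /pP.
Qed.

Lemma next_prime_ex m : exists p, (m < p) && prime p.
Proof. by have [p ltmp p_pr] := prime_above m; exists p; rewrite ltmp. Qed.

Definition next_prime m := ex_minn (next_prime_ex m).
Definition nth_prime i := iter i.+1 next_prime 0.

Lemma recursive_next_prime n (f : n.-tuple nat -> nat) :
  recursive f -> recursive (fun v => next_prime (f v)).
Proof.
move=> rf; apply: (recursive_find (P := fun p v => (f v < p) && prime p)).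
- by apply: recursive_and; [auto with rec | apply/recursive_prime/recursive_thead].
- by move=> v; rewrite /next_prime; case: ex_minnP.
- move=> v k; rewrite /next_prime; case: ex_minnP => p _ minp ltkp.
  by apply/negP => /minp; rewrite leqNgt ltkp.
Qed.

Lemma recursive_nth_prime n (f : n.-tuple nat -> nat) :
  recursive f -> recursive (fun v => nth_prime (f v)).
Proof.
move=> rf; apply: recursive_ext (recursive_iteri (recursive_succ rf) (rec_zero n)
  (s := fun _ x _ => next_prime x) _) _.
  by apply/recursive_next_prime/recursive_second.
by move=> v; rewrite /nth_prime; elim: (f v).+1 => //= k ->.
Qed.

Lemma prime_nth_prime i : prime (nth_prime i).
Proof. by rewrite /nth_prime /= /next_prime; case: ex_minnP => p /andP[]. Qed.

Lemma nth_prime_inj : injective nth_prime.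
Proof.
have lt i : nth_prime i < nth_prime i.+1.
  by rewrite {2}/nth_prime iterS -/(nth_prime i) /next_prime; case: ex_minnP => p /andP[].
have mono i j : i < j -> nth_prime i < nth_prime j.
  elim: j => // j IHj; rewrite ltnS leq_eqVlt => /predU1P[-> //|/IHj ltij].
  exact: ltn_trans (lt j).
by move=> i j eqij; case: (ltngtP i j) => // /mono; rewrite eqij ltnn.
Qed.

#[local] Hint Resolve recursive_half recursive_prime recursive_nth_prime : rec.

(* A number e < p ^ c is a table assigning to each label i < c its i-th base-p digit. *)
Definition digit p e i := e %/ p ^ i %% p.

Lemma recursive_digit n (p e i : n.-tuple nat -> nat) : recursive p -> recursive e ->
  recursive i -> recursive (fun v => digit (p v) (e v) (i v)).
Proof. by rewrite /digit; auto with rec. Qed.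
#[local] Hint Resolve recursive_digit : rec.

(* The letter l acts by t |-> u t + a, where u, a and v = u^-1 are read modulo p
   in the tables e1, e2 and e3. *)
Definition affine_step p e1 e2 e3 x t :=
  if odd x then digit p e3 x./2 * (t + (p - digit p e2 x./2))
  else digit p e1 x./2 * t + digit p e2 x./2.

Lemma recursive_affine_step n (p e1 e2 e3 x t : n.-tuple nat -> nat) :
  recursive p -> recursive e1 -> recursive e2 -> recursive e3 -> recursive x -> recursive t ->
  recursive (fun v => affine_step (p v) (e1 v) (e2 v) (e3 v) (x v) (t v)).
Proof. by rewrite /affine_step; auto 10 with rec. Qed.
#[local] Hint Resolve recursive_affine_step : rec.

Definition word_value p e1 e2 e3 w :=
  foldr (fun x t => affine_step p e1 e2 e3 x t) 0 (decode w).

Lemma recursive_word_value n (p e1 e2 e3 w : n.-tuple nat -> nat) :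
  recursive p -> recursive e1 -> recursive e2 -> recursive e3 -> recursive w ->
  recursive (fun v => word_value (p v) (e1 v) (e2 v) (e3 v) (w v)).
Proof.
move=> *; apply: (recursive_foldr (s := fun x t v =>
  affine_step (p v) (e1 v) (e2 v) (e3 v) x t)); auto with rec.
Qed.
#[local] Hint Resolve recursive_word_value : rec.

(** The head of [c] is the rank and [tl c] codes the list of words. Labels of an input are below its
    code, so tables with [c] digits are enough. *)
Definition solution c l0 p e1 e2 e3 :=
  [&& prime p, all (fun l => (digit p e1 l * digit p e3 l) %% p == 1) (iota 0 c),
    digit p e2 l0 == 1 & all (fun w => p %| word_value p e1 e2 e3 w) (decode (tl c))].

Lemma recursive_solution n (c l0 p e1 e2 e3 : n.-tuple nat -> nat) :
  recursive c -> recursive l0 -> recursive p -> recursive e1 -> recursive e2 -> recursive e3 ->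
  recursive (fun v => solution (c v) (l0 v) (p v) (e1 v) (e2 v) (e3 v)).
Proof.
rewrite /solution => *; repeat apply: recursive_and; auto 10 with rec.
Qed.
#[local] Hint Resolve recursive_solution : rec.

(** The numbers below [p ^ c] represent all tables with [c] digits, so the nested bounded searches
    are exhaustive. *)
Definition solvable3 c l0 p e1 e2 := has (fun e3 => solution c l0 p e1 e2 e3) (iota 0 (p ^ c)).
Definition solvable2 c l0 p e1 := has (fun e2 => solvable3 c l0 p e1 e2) (iota 0 (p ^ c)).
Definition solvable c l0 p := has (fun e1 => solvable2 c l0 p e1) (iota 0 (p ^ c)).

Lemma recursive_solvable n (c l0 p : n.-tuple nat -> nat) :
  recursive c -> recursive l0 -> recursive p ->
  recursive (fun v => solvable (c v) (l0 v) (p v)).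
Proof.
have r3 m (c' l0' p' e1 e2 : m.-tuple nat -> nat) :
  recursive c' -> recursive l0' -> recursive p' -> recursive e1 -> recursive e2 ->
  recursive (fun v => solvable3 (c' v) (l0' v) (p' v) (e1 v) (e2 v)).
  by rewrite /solvable3; auto 10 with rec.
have r2 m (c' l0' p' e1 : m.-tuple nat -> nat) :
  recursive c' -> recursive l0' -> recursive p' -> recursive e1 ->
  recursive (fun v => solvable2 (c' v) (l0' v) (p' v) (e1 v)).
  by rewrite /solvable2; auto 10 with rec.
by rewrite /solvable; auto 10 with rec.
Qed.
#[local] Hint Resolve recursive_solvable : rec.

(* Monomials are positive integers, the variables being distinct primes, so that
   monomials multiply as integers; 0 stands for an absent monomial.  The letter l
   acts by t |-> u_l t + a_l and v_l is u_l^-1; z_w is the image of 0 under the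
   word with code w. *)
Definition var_u l := nth_prime (4 * l).
Definition var_v l := nth_prime (4 * l + 1).
Definition var_a l := nth_prime (4 * l + 2).
Definition var_z w := nth_prime (4 * w + 3).

Lemma recursive_var_u n (f : n.-tuple nat -> nat) : recursive f -> recursive (fun v => var_u (f v)).
Proof. by rewrite /var_u; auto with rec. Qed.
Lemma recursive_var_v n (f : n.-tuple nat -> nat) : recursive f -> recursive (fun v => var_v (f v)).
Proof. by rewrite /var_v; auto with rec. Qed.
Lemma recursive_var_a n (f : n.-tuple nat -> nat) : recursive f -> recursive (fun v => var_a (f v)).
Proof. by rewrite /var_a; auto with rec. Qed.
Lemma recursive_var_z n (f : n.-tuple nat -> nat) : recursive f -> recursive (fun v => var_z (f v)).
Proof. by rewrite /var_z; auto with rec. Qed.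
#[local] Hint Resolve recursive_var_u recursive_var_v recursive_var_a recursive_var_z : rec.

(* Relation (ty, i) reads p1 + p2 = n1 + n2.  Type 0 computes z_i from the z of the
   tail of the word i, type 1 is u_i v_i = 1, type 2 is z_i = 0 if i codes an input
   word, and any other type is a_l0 = 1. *)
Definition rel_p1 c l0 ty i :=
  if ty == 0 then
    if i == 0 then var_z 0 else
    if odd (hd i) then var_u (hd i)./2 * var_z i else var_z i
  else if ty == 1 then var_u i * var_v i
  else if ty == 2 then if has (fun w => w == i) (decode (tl c)) then var_z i else 0
  else var_a l0.

(** For an inverse letter, z_i = v (z_t - a) is rewritten as u z_i + a = z_t, which avoids signs and
    keeps two monomials per side. *)
Definition rel_p2 ty i :=
  if (ty == 0) && (i != 0) && odd (hd i) then var_a (hd i)./2 else 0.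

Definition rel_n1 ty i :=
  if ty == 0 then
    if i == 0 then 0 else
    if odd (hd i) then var_z (tl i) else var_u (hd i)./2 * var_z (tl i)
  else if ty == 2 then 0 else 1.

Definition rel_n2 ty i :=
  if (ty == 0) && (i != 0) && ~~ odd (hd i) then var_a (hd i)./2 else 0.

Lemma recursive_rel_p1 n (c l0 ty i : n.-tuple nat -> nat) :
  recursive c -> recursive l0 -> recursive ty -> recursive i ->
  recursive (fun v => rel_p1 (c v) (l0 v) (ty v) (i v)).
Proof. by rewrite /rel_p1; auto 10 with rec. Qed.

Lemma recursive_rel_p2 n (ty i : n.-tuple nat -> nat) :
  recursive ty -> recursive i -> recursive (fun v => rel_p2 (ty v) (i v)).
Proof. by rewrite /rel_p2; auto 10 with rec. Qed.

Lemma recursive_rel_n1 n (ty i : n.-tuple nat -> nat) :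
  recursive ty -> recursive i -> recursive (fun v => rel_n1 (ty v) (i v)).
Proof. by rewrite /rel_n1; auto 10 with rec. Qed.

Lemma recursive_rel_n2 n (ty i : n.-tuple nat -> nat) :
  recursive ty -> recursive i -> recursive (fun v => rel_n2 (ty v) (i v)).
Proof. by rewrite /rel_n2; auto 10 with rec. Qed.
#[local] Hint Resolve recursive_rel_p1 recursive_rel_p2 recursive_rel_n1 recursive_rel_n2 : rec.

(* A certificate is a list of items [s; m; ty; i], each standing for the monomial m
   times the relation (ty, i), with its sides exchanged if s is odd. *)
Definition field j t := hd (iter j tl t).

Lemma recursive_field n (j t : n.-tuple nat -> nat) :
  recursive j -> recursive t -> recursive (fun v => field (j v) (t v)).
Proof. by rewrite /field; auto with rec. Qed.
#[local] Hint Resolve recursive_field : rec.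

(** The two sides are counted apart because counts are natural numbers. Absent monomials are counted
    at [M] = 0, a value that no test inspects. *)
Definition item_pos c l0 t M :=
  (field 1 t * rel_p1 c l0 (field 2 t) (field 3 t) == M) +
  (field 1 t * rel_p2 (field 2 t) (field 3 t) == M).

Definition item_neg t M :=
  (field 1 t * rel_n1 (field 2 t) (field 3 t) == M) +
  (field 1 t * rel_n2 (field 2 t) (field 3 t) == M).

(** No monomial of the item exceeds this sum, so only finitely many coefficients need checking. *)
Definition item_bound c l0 t :=
  field 1 t * (rel_p1 c l0 (field 2 t) (field 3 t) + rel_p2 (field 2 t) (field 3 t) +
               rel_n1 (field 2 t) (field 3 t) + rel_n2 (field 2 t) (field 3 t)).

Definition coef_pos c l0 k M :=
  foldr (fun t x => (if odd (field 0 t) then item_neg t M else item_pos c l0 t M) + x) 0 (decode k).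

Definition coef_neg c l0 k M :=
  foldr (fun t x => (if odd (field 0 t) then item_pos c l0 t M else item_neg t M) + x) 0 (decode k).

Definition coef_bound c l0 k := foldr (fun t x => item_bound c l0 t + x) 0 (decode k).

Lemma recursive_item_pos n (c l0 t M : n.-tuple nat -> nat) :
  recursive c -> recursive l0 -> recursive t -> recursive M ->
  recursive (fun v => item_pos (c v) (l0 v) (t v) (M v)).
Proof. by rewrite /item_pos; auto 10 with rec. Qed.

Lemma recursive_item_neg n (t M : n.-tuple nat -> nat) :
  recursive t -> recursive M -> recursive (fun v => item_neg (t v) (M v)).
Proof. by rewrite /item_neg; auto 10 with rec. Qed.

Lemma recursive_item_bound n (c l0 t : n.-tuple nat -> nat) :
  recursive c -> recursive l0 -> recursive t ->
  recursive (fun v => item_bound (c v) (l0 v) (t v)).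
Proof. by rewrite /item_bound; auto 10 with rec. Qed.
#[local] Hint Resolve recursive_item_pos recursive_item_neg recursive_item_bound : rec.

Lemma recursive_coef_pos n (c l0 k M : n.-tuple nat -> nat) :
  recursive c -> recursive l0 -> recursive k -> recursive M ->
  recursive (fun v => coef_pos (c v) (l0 v) (k v) (M v)).
Proof.
move=> *; apply: (recursive_foldr (s := fun t x v =>
  (if odd (field 0 t) then item_neg t (M v) else item_pos (c v) (l0 v) t (M v)) + x));
  auto 10 with rec.
Qed.

Lemma recursive_coef_neg n (c l0 k M : n.-tuple nat -> nat) :
  recursive c -> recursive l0 -> recursive k -> recursive M ->
  recursive (fun v => coef_neg (c v) (l0 v) (k v) (M v)).
Proof.
move=> *; apply: (recursive_foldr (s := fun t x v =>
  (if odd (field 0 t) then item_pos (c v) (l0 v) t (M v) else item_neg t (M v)) + x));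
  auto 10 with rec.
Qed.

Lemma recursive_coef_bound n (c l0 k : n.-tuple nat -> nat) :
  recursive c -> recursive l0 -> recursive k ->
  recursive (fun v => coef_bound (c v) (l0 v) (k v)).
Proof.
move=> *; apply: (recursive_foldr (s := fun t x v => item_bound (c v) (l0 v) t + x));
  auto 10 with rec.
Qed.
#[local] Hint Resolve recursive_coef_pos recursive_coef_neg recursive_coef_bound : rec.

(** The combination is a nonzero integer: every monomial other than 1 cancels, and the constant does
    not. [M] = 0 is exempt since it codes an absent monomial. *)
Definition certificate c l0 k :=
  all (fun M => (M <= 1) || (coef_pos c l0 k M == coef_neg c l0 k M))
    (iota 0 (coef_bound c l0 k).+2)
  && (coef_pos c l0 k 1 != coef_neg c l0 k 1).

Lemma recursive_certificate n (c l0 k : n.-tuple nat -> nat) :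
  recursive c -> recursive l0 -> recursive k ->
  recursive (fun v => certificate (c v) (l0 v) (k v)).
Proof. by rewrite /certificate; auto 10 with rec. Qed.
#[local] Hint Resolve recursive_certificate : rec.

(* The first alternative only makes the search total: labels occurring in an input
   are smaller than its code. *)
Definition conclusive c l0 k :=
  [|| c <= l0, has (fun p => solvable c l0 p) (iota 0 k) | certificate c l0 k].

Lemma recursive_conclusive n (c l0 k : n.-tuple nat -> nat) :
  recursive c -> recursive l0 -> recursive k ->
  recursive (fun v => conclusive (c v) (l0 v) (k v)).
Proof. by rewrite /conclusive; auto 10 with rec. Qed.
#[local] Hint Resolve recursive_conclusive : rec.

Definition occurs c l := has (fun w => has (fun x => x./2 == l) (decode w)) (decode (tl c)).

Lemma recursive_occurs n (c l : n.-tuple nat -> nat) :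
  recursive c -> recursive l -> recursive (fun v => occurs (c v) (l v)).
Proof.
move=> rc rl.
have r1 m (w l' : m.-tuple nat -> nat) : recursive w -> recursive l' ->
  recursive (fun v => has (fun x => x./2 == l' v) (decode (w v))).
  by auto 10 with rec.
by rewrite /occurs; auto 10 with rec.
Qed.
#[local] Hint Resolve recursive_occurs : rec.

Definition nb_labels c := \sum_(l < c) occurs c l.

Lemma recursive_nb_labels n (c : n.-tuple nat -> nat) :
  recursive c -> recursive (fun v => nb_labels (c v)).
Proof.
by move=> rc; apply: (recursive_sum (F := fun l v => occurs (c v) l)); auto with rec.
Qed.
#[local] Hint Resolve recursive_nb_labels : rec.

Section Decision.
Hypothesis conclusive_ex : forall c l0, exists k, conclusive c l0 k.

(** Totality is a hypothesis here, discharged later by a classical argument; the value is a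
    minimization of a recursive predicate whatever the proof of existence. *)
Definition search c l0 := ex_minn (conclusive_ex c l0).

Lemma recursive_search n (c l0 : n.-tuple nat -> nat) :
  recursive c -> recursive l0 -> recursive (fun v => search (c v) (l0 v)).
Proof.
move=> rc rl; apply: (recursive_find (P := fun k v => conclusive (c v) (l0 v) k)).
- by auto with rec.
- by move=> v; rewrite /search; case: ex_minnP.
- move=> v k; rewrite /search; case: ex_minnP => m _ minm ltkm.
  by apply/negP => /minm; rewrite leqNgt ltkm.
Qed.

(* The constant left over by a certificate vanishes modulo the characteristic of any
   solution, which bounds that characteristic. *)
Definition decide c l0 := has (fun p => solvable c l0 p)
  (iota 0 (search c l0 + coef_pos c l0 (search c l0) 1 + coef_neg c l0 (search c l0) 1).+1).

(** [hd c] is 0 for infinite rank and n + 1 for rank n. The middle test says that every basis letter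
    occurs; x0 can then be sought among the occurring labels. *)
Definition answer c :=
  [&& hd c != 0, nb_labels c == (hd c).-1 &
    ~~ has (fun l => occurs c l && decide c l) (iota 0 c)].

Lemma recursive_answer : recursive (fun v : 1.-tuple nat => answer (thead v)).
Proof.
have rs := recursive_search.
have rd n (c l0 : n.-tuple nat -> nat) :
    recursive c -> recursive l0 -> recursive (fun v => decide (c v) (l0 v)).
  by move=> rc rl; rewrite /decide; have := rs _ _ _ rc rl; auto 10 with rec.
by rewrite /answer; auto 10 with rec.
Qed.
End Decision.

Import GRing.Theory Num.Theory.
Local Open Scope ring_scope.

(** * Points over prime fields *)

Definition ideal_pred (R : comNzRingType) (P : R -> Prop) : Prop :=
  [/\ P 0, forall x y, P x -> P y -> P (x + y) & forall x y, P y -> P (x * y)].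

Definition prime_pred (R : comNzRingType) (P : R -> Prop) : Prop :=
  ~ P 1 /\ forall x y, P (x * y) -> P x \/ P y.

Definition char0_pred (R : comNzRingType) (P : R -> Prop) : Prop :=
  forall n, ~ P n.+1%:R.

(** A form of the Nullstellensatz over the rationals. The element [s] carries the induction on the
    number of variables: with it, a chosen leading coefficient can be kept nonzero. *)
Definition specializes (R : comNzRingType) : Prop :=
  forall P : R -> Prop, ideal_pred P -> prime_pred P -> char0_pred P ->
  forall s, ~ P s ->
  exists2 phi : {rmorphism R -> algC}, (forall x, P x -> phi x = 0) & phi s != 0.

(** Among the ideals of the integers only the zero ideal contains no positive integer, so the
    inclusion into [algC] serves. *)
Lemma specializes_int : specializes int.
Proof.
move=> P [P0 PD PM] _ Pchar s Ps.
exists (intr : {rmorphism int -> algC}) => [x Px|]; last first.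
  by rewrite intr_eq0; apply/eqP => s0; apply: Ps; rewrite s0.
case: x Px => [[//|n] | n] Px; first by case: (Pchar n); rewrite natz.
by case: (Pchar n); have:= PM (-1) _ Px; rewrite NegzE mulrN mulN1r opprK natz.
Qed.

Lemma idealX (R : comNzRingType) (P : R -> Prop) (c : R) n :
  prime_pred P -> ~ P c -> ~ P (c ^+ n).
Proof.
move=> [P1 PP] Pc; elim: n => [|n IHn]; first by rewrite expr0.
by rewrite exprS => /PP[].
Qed.

Lemma idealN (R : comNzRingType) (P : R -> Prop) x :
  ideal_pred P -> P x -> P (- x).
Proof. by move=> [_ _ PM] Px; rewrite -mulN1r; apply: PM. Qed.

Lemma ideal_sum (R : comNzRingType) (P : R -> Prop) I (r : seq I) (Q : pred I) F :
  ideal_pred P -> (forall i, Q i -> P (F i)) -> P (\sum_(i <- r | Q i) F i).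
Proof. by move=> [P0 PD _] PF; elim/big_ind: _. Qed.

Section Contraction.
Variables (R : idomainType) (P0 : R -> Prop).
Hypothesis P0I : ideal_pred P0.

(** The extension of [P0] to R[X], that is, the polynomials that vanish modulo [P0]. *)
Definition coefs_in (g : {poly R}) : Prop := forall i, P0 g`_i.

Lemma coefs_in_ideal : ideal_pred coefs_in.
Proof.
have [P00 P0D P0M] := P0I; split=> [i|f g Pf Pg i|f g Pg i].
- by rewrite coef0.
- by rewrite coefD; apply: P0D.
- by rewrite coefM; apply: ideal_sum => // j _; apply: P0M.
Qed.

Section Min.
Variable J : {poly R} -> Prop.
Hypothesis JI : ideal_pred J.
Hypothesis P0J : forall g, coefs_in g -> J g.

(** A leading term with coefficient in [P0] lies in [J] and can be removed; this ends before the
    polynomial is exhausted, because some coefficient is outside [P0]. *)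
Lemma strip_lead g : J g -> ~ coefs_in g ->
  exists f, [/\ J f, ~ P0 (lead_coef f) & (size f <= size g)%N].
Proof.
have [n] := ubnP (size g); elim: n g => // n IHn g ltgn Jg Pg.
have [P0c|] := pselect (P0 (lead_coef g)); last by exists g.
have [J0 JD JM] := JI; have [P00 _ _] := P0I.
have g0 : g != 0.
  by apply/eqP => g0; apply: Pg => i; rewrite g0 coef0.
pose t : {poly R} := lead_coef g *: 'X^((size g).-1).
have Pt : coefs_in t.
  by move=> i; rewrite coefZ coefXn; case: eqP => _; rewrite ?mulr1 ?mulr0.
have ltgt : (size (g - t)%R < size g)%N.
  rewrite -(prednK (_ : 0 < size g)%N) ?size_poly_gt0 // ltnS.
  apply/leq_sizeP => j; rewrite leq_eqVlt coefB coefZ coefXn => /predU1P[<-|ltj].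
    by rewrite eqxx mulr1 -lead_coefE subrr.
  rewrite gtn_eqF // mulr0 subr0 nth_default //.
  by rewrite -(prednK (_ : 0 < size g)%N) ?size_poly_gt0.
have [||f [Jf Pf lefg]] := IHn (g - t) _ (JD _ _ Jg (idealN JI (P0J Pt))).
- exact: leq_trans ltgt _.
- move=> Pgt; apply: Pg; rewrite -(subrK t g).
  by case: coefs_in_ideal => _ PD _; apply: PD.
- by exists f; split=> //; apply: leq_trans lefg (ltnW ltgt).
Qed.

(** When [P0] is prime, [f] plays the part of a generator of [J] over the fraction field of R /
    [P0]: remainders modulo [f] vanish modulo [P0]. *)
Lemma min_lead g : J g -> ~ coefs_in g ->
  exists f, [/\ J f, ~ P0 (lead_coef f) &
    forall h, J h -> (size h < size f)%N -> coefs_in h].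
Proof.
move=> Jg Pg; pose Q n := `[< exists f, [/\ J f, ~ P0 (lead_coef f) & size f = n] >].
have exQ : exists n, Q n.
  by have [f [Jf Pf _]] := strip_lead Jg Pg; exists (size f); apply/asboolP; exists f.
have [n /asboolP[f [Jf Pf <-]] minf] := ex_minnP exQ.
exists f; split=> // h Jh; apply: contraPP => Ph.
have [f' [Jf' Pf' lef']] := strip_lead Jh Ph.
have /minf le1 : Q (size f') by apply/asboolP; exists f'.
by apply/negP; rewrite -leqNgt (leq_trans le1).
Qed.
End Min.

End Contraction.

Lemma pseudo_division (R : idomainType) (f g : {poly R}) : f != 0 ->
  exists e q r, lead_coef f ^+ e *: g = q * f + r /\ (size r < size f)%N.
Proof.
move=> f0; exists (Pdiv.Ring.rscalp g f), (Pdiv.Ring.rdivp g f), (Pdiv.Ring.rmodp g f).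
by rewrite Pdiv.ComRing.rdivp_eq Pdiv.Ring.ltn_rmodp.
Qed.

Lemma nonroot (p : {poly algC}) : p != 0 -> exists x, p.[x] != 0.
Proof.
move=> p0; apply: contrapT => px.
have uniqn : uniq [seq i%:R : algC | i <- iota 0 (size p)].
  by rewrite map_inj_uniq ?iota_uniq // => i j /eqP; rewrite eqr_nat => /eqP.
have /(max_poly_roots p0)/(_ uniqn) : all (root p) [seq i%:R | i <- iota 0 (size p)].
  apply/allP => _ /mapP[i _ ->]; apply/negPn/negP => nr.
  by apply: px; exists i%:R.
by rewrite size_map size_iota ltnn.
Qed.

(* For P prime in R[X] with contraction P0: modulo P0 and up to powers of its leading
   coefficient, the element f of P of least degree with leading coefficient outside
   P0 generates P, so any root of the image of f defines a specialization.  Working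
   with pseudo-division upstairs avoids residue fields. *)
Lemma specializes_poly (R : idomainType) :
  specializes R -> specializes {poly R}.
Proof.
move=> spR P PI [P1 PP] Pchar s Ps; have [P_0 PD PM] := PI.
pose P0 x := P x%:P.
have P0I : ideal_pred P0.
  split=> [|x y Px Py|x y Py]; rewrite /P0 ?polyC0 ?polyCD ?polyCM //.
    exact: PD.
  exact: PM.
have P0prime : prime_pred P0.
  by split=> [|x y]; rewrite /P0 ?polyC1 // polyCM => /PP.
have P0char : char0_pred P0 by move=> n; rewrite /P0 polyC_natr; apply: Pchar.
have P0sub g : coefs_in P0 g -> P g.
  move=> Pg; rewrite -[g]coefK poly_def; apply: ideal_sum => // i _.
  by rewrite -mul_polyC mulrC; apply/PM/Pg.
have P0neq0 c : ~ P0 c -> c != 0.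
  by move=> Pc; apply/eqP => c0; apply: Pc; rewrite c0; case: P0I.
have coefsI := coefs_in_ideal P0I.
have kill (phi : {rmorphism R -> algC}) g :
    (forall x, P0 x -> phi x = 0) -> coefs_in P0 g -> map_poly phi g = 0.
  by move=> phi0 Pg; apply/polyP => i; rewrite coef_map coef0; apply/phi0/Pg.
(* If [P] is no larger than the extension of [P0], the variable may take any value at which the
   image of [s] does not vanish. *)
have [alg|] := pselect (exists2 g, P g & ~ coefs_in P0 g); last first.
  move=> trans; have Ptrans g : P g -> coefs_in P0 g.
    by move=> Pg; apply: contrapT => nPg; apply: trans; exists g.
  have [i Psi] : exists i, ~ P0 s`_i.
    by apply: contrapT => H; apply/Ps/P0sub => i; apply: contrapT => Hi; apply: H; exists i.
  have [phi phi0 phis] := spR P0 P0I P0prime P0char _ Psi.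
  have [|x sx] := @nonroot (map_poly phi s).
    by apply: contraNneq phis => phis; rewrite -coef_map phis coef0.
  exists (horner_eval x \o map_poly phi) => [g Pg|//] /=.
  by rewrite /horner_eval kill ?horner0 //; apply: Ptrans.
have [g Pg nPg] := alg.
have [f [Pf Pc minf]] := min_lead P0I PI P0sub Pg nPg.
have f0 : f != 0 by rewrite -lead_coef_eq0 P0neq0.
(* Modulo [P] the constant [c] is a multiple of [s], so a specialization that keeps [c] nonzero
   keeps [s] nonzero. *)
have [c Pcc cJ] : exists2 c, ~ P0 c & exists h t, P h /\ c%:P = h + t * s.
  pose J g := exists h t, P h /\ g = h + t * s.
  have JI : ideal_pred J.
    split=> [|_ _ [h [t [Ph ->]]] [h' [t' [Ph' ->]]]|x _ [h [t [Ph ->]]]].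
    - by exists 0, 0; rewrite mul0r addr0.
    - by exists (h + h'), (t + t'); split; [apply: PD | rewrite mulrDl addrACA].
    - by exists (x * h), (x * t); split; [apply: PM | rewrite mulrDr mulrA].
  have PJ h : P h -> J h by exists h, 0; rewrite mul0r addr0.
  have [|h [Jh Ph minh]] := min_lead P0I JI (fun g Pg => PJ g (P0sub g Pg)) _ nPg.
    exact: PJ.
  have h0 : h != 0 by rewrite -lead_coef_eq0 P0neq0.
  have [_ JD JM] := JI.
  have sub u v : J u -> J v -> J (u - v).
    by move=> Ju Jv; apply: JD => //; apply: idealN.
  have [sh1|sh1] := leqP (size h) 1.
    exists h`_0; last by move: Jh; rewrite /J -size1_polyC.
    by move: Ph; rewrite lead_coefE (_ : (size h).-1 = 0%N) //; case: (size h) sh1 => [|[]].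
  (* For nonconstant [h], dividing [f] puts [q * h] in [P]. If [q] is in [P], its degree is below
     that of [f], so its coefficients are in [P0], and then so is the leading coefficient of [f]. If
     [h] is in [P], dividing [s] by [h] puts [s] in [P]. Both are absurd. *)
  have [e [q [r [eqr ltr]]]] := pseudo_division f h0.
  have Pr : coefs_in P0 r.
    apply: minh => //; have -> : r = lead_coef h ^+ e *: f - q * h by rewrite eqr addrC addKr.
    by rewrite -mul_polyC; apply: sub; apply: JM => //; apply: PJ.
  have qhE : q * h = lead_coef h ^+ e *: f - r by rewrite eqr addrK.
  have Pqh : P (q * h).
    rewrite qhE -mul_polyC; apply: PD; first exact: PM.
    by apply: idealN => //; apply: P0sub.
  have lthf : (size h <= size f)%N.
    by rewrite leqNgt; apply/negP => /(minh _ (PJ _ Pf)) /(_ (size f).-1).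
  have [Pq|Ph'] := PP _ _ Pqh.
    have P0q : coefs_in P0 q.
      have [->|q0] := eqVneq q 0; first by case: coefsI.
      have le_sz : (size (q * h)%R <= size f)%N.
        rewrite qhE (leq_trans (size_polyD _ _)) // size_polyN geq_max.
        by rewrite size_scale_leq (leq_trans (ltnW ltr)).
      by apply: minf => //; move: le_sz; rewrite size_mul //; lia.
    have [_ CD CM] := coefsI.
    have /(_ (size f).-1) : coefs_in P0 (lead_coef h ^+ e *: f).
      by rewrite eqr; apply: CD => //; rewrite mulrC; apply: CM.
    by rewrite coefZ => /(proj2 P0prime)[/(idealX P0prime Ph)|].
  have [e' [q' [r' [eqr' ltr']]]] := pseudo_division s h0.
  have Pr' : P r'.
    apply: P0sub; apply: minh => //.
    have -> : r' = lead_coef h ^+ e' *: s - q' * h by rewrite eqr' addrC addKr.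
    rewrite -mul_polyC; apply: sub; apply: JM => //.
    by exists 0, 1; rewrite mul1r add0r.
  have : P ((lead_coef h ^+ e')%:P * s).
    by rewrite mul_polyC eqr'; apply: PD => //; apply: PM.
  by case/PP => // /(idealX P0prime Ph).
(* Keeping [lead_coef f] nonzero preserves the positive degree of [f], so its image has a root. *)
have [|phi phi0 phic] := spR P0 P0I P0prime P0char (lead_coef f * c).
  by case/(proj2 P0prime).
move: phic; rewrite rmorphM mulf_eq0 negb_or => /andP[phif phic].
have [x fx] : exists x, root (map_poly phi f) x.
  apply/closed_rootP; rewrite size_poly_eq // neq_ltn; apply/orP; right.
  rewrite ltnNge; apply/negP => sf1; apply: Pc; rewrite /P0.
  have -> : lead_coef f = f`_0 by rewrite lead_coefE; case: (size f) sf1 => [|[]].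
  by rewrite -size1_polyC.
pose psi : {rmorphism {poly R} -> algC} := horner_eval x \o map_poly phi.
have psiC d : psi d%:P = phi d by rewrite /psi /= /horner_eval map_polyC hornerC.
have psi0 g' : P g' -> psi g' = 0.
  move=> Pg'; have [e [q [r [eqr ltr]]]] := pseudo_division g' f0.
  have Pr : coefs_in P0 r.
    apply: minf => //; have -> : r = lead_coef f ^+ e *: g' - q * f by rewrite eqr addrC addKr.
    by apply: PD; rewrite -?mul_polyC; [|apply: idealN => //]; apply: PM.
  have psif : psi f = 0 by apply/eqP.
  have psir : psi r = 0 by rewrite /psi /= /horner_eval kill ?horner0.
  have /eqP := congr1 psi eqr.
  rewrite -mul_polyC polyC_exp rmorphM rmorphXn psiC rmorphD rmorphM psif psir mulr0 addr0.
  by rewrite mulf_eq0 expf_eq0 (negPf phif) andbF => /eqP.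
exists psi => //; have [h [t [Ph /(congr1 psi)]]] := cJ.
rewrite rmorphD rmorphM (psi0 h Ph) add0r psiC => eqc.
by apply: contraNneq phic => s0; rewrite eqc s0 mulr0.
Qed.

(** * Ideals without positive integers; primes dividing polynomial values *)

Definition in_ideal (R : comNzRingType) (rs : seq R) (x : R) : Prop :=
  exists g : nat -> R, x = \sum_(i < size rs) g i * rs`_i.

Lemma ideal_in_ideal (R : comNzRingType) (rs : seq R) : ideal_pred (in_ideal rs).
Proof.
split=> [|_ _ [g ->] [h ->]|x _ [g ->]].
- by exists (fun=> 0); rewrite big1 // => i _; rewrite mul0r.
- by exists (fun i => g i + h i); rewrite -big_split; apply: eq_bigr => i _; rewrite mulrDl.
- by exists (fun i => x * g i); rewrite mulr_sumr; apply: eq_bigr => i _; rewrite mulrA.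
Qed.

Lemma in_ideal_mem (R : comNzRingType) (rs : seq R) x : x \in rs -> in_ideal rs x.
Proof.
move=> xrs; have ltx : (index x rs < size rs)%N by rewrite index_mem.
exists (fun i => (i == index x rs)%:R); rewrite (bigD1 (Ordinal ltx)) //=.
rewrite eqxx mul1r nth_index // big1 ?addr0 // => i /negPf.
by rewrite -val_eqE /= => ->; rewrite mul0r.
Qed.

(** An ideal maximal among those without positive integers is prime: if a and b lie outside,
    adjoining either brings in a positive integer, and the product of the two integers lies in the
    ideal as soon as a b does. *)
Lemma char0_prime (R : comNzRingType) (I : R -> Prop) :
  ideal_pred I -> char0_pred I ->
  exists P, [/\ ideal_pred P, prime_pred P, char0_pred P & forall x, I x -> P x].
Proof.
move=> II Ichar; have [I0 ID IM] := II.
pose good (P : R -> Prop) := [/\ ideal_pred P, char0_pred P & forall x, I x -> P x].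
have [F Fgood totF|A [Agood maxA]] :=
    @classical_sets.Zorn_bigcup R (fun A => A = classical_sets.set0 \/ good A).
  have [[A FA Agood]|none] := pselect (exists2 A, F A & good A); last first.
    left; apply/classical_sets.seteqP; split=> // x [A FA Ax]; have [A0|gA] := Fgood _ FA.
      by rewrite A0 in Ax.
    by case: none; exists A.
  have [[A0 AD AM] _ IA] := Agood.
  have goodF B x : F B -> B x -> good B.
    by move=> FB Bx; have [B0|//] := Fgood _ FB; rewrite B0 in Bx.
  right; split=> [|n [B FB Bn]|x Ix]; last by exists A => //; apply: IA.
    split=> [|x y [B FB Bx] [C FC Cy]|x y [B FB By]]; first by exists A.
      have [BC|CB] := totF _ _ FB FC.
        by exists C => //; have [[_ CD _] _ _] := goodF _ _ FC Cy; apply: CD => //; apply: BC.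
      by exists B => //; have [[_ CD _] _ _] := goodF _ _ FB Bx; apply: CD => //; apply: CB.
    by exists B => //; have [[_ _ CM] _ _] := goodF _ _ FB By; apply: CM.
  by have [_ Bchar _] := goodF _ _ FB Bn; apply: (Bchar n).
case: Agood => [A0|[AI Achar IA]].
  case: (maxA I); last by right; split.
  by rewrite A0; split=> [x //|sub]; apply: (sub 0).
have [A0 AD AM] := AI; exists A; split=> //.
pose adj a x := exists p y, A p /\ x = p + y * a.
have adjP a : ~ A a -> exists n, adj a n.+1%:R.
  move=> Aa; apply: contrapT => nochar; case: (maxA (adj a)).
    split=> [x Ax|sub]; first by exists x, 0; rewrite mul0r addr0.
    by apply: Aa; apply: sub; exists 0, 1; rewrite mul1r add0r.
  right; split=> [|n Hn|x Ix]; last by exists x, 0; rewrite mul0r addr0; split=> //; apply: IA.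
    split=> [|_ _ [p [y [Ap ->]]] [q [z [Aq ->]]]|x _ [p [y [Ap ->]]]].
    - by exists 0, 0; rewrite mul0r addr0.
    - by exists (p + q), (y + z); split; [apply: AD | rewrite mulrDl addrACA].
    - by exists (x * p), (x * y); split; [apply: AM | rewrite mulrDr mulrA].
  by apply: nochar; exists n.
split=> [A1|a b Aab]; first by apply: (Achar 0%N).
apply: contrapT => /not_orP[/adjP[n [p [x [Ap en]]]] /adjP[m [q [y [Aq em]]]]].
apply: (Achar (n.+1 * m.+1).-1); rewrite prednK // natrM en em.
rewrite mulrDl; apply: (AD); first by rewrite mulrC; apply: (AM).
rewrite mulrDr; apply: (AD); first exact: (AM).
by rewrite mulrACA; apply: AM.
Qed.

(* With c = U(0), the integer U(D c t) is c times some 1 + D w, all of whose prime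
   factors are prime to D. *)
Lemma schur (U : {poly int}) (D : int) : (1 < size U)%N -> D != 0 ->
  exists (p : nat) (r : int), [/\ prime p, ~~ (p%:Z %| D)%Z & (p%:Z %| U.[r])%Z].
Proof.
move=> sU D0.
have root_ok r : U.[r] = 0 -> exists (p : nat) (r : int),
    [/\ prime p, ~~ (p%:Z %| D)%Z & (p%:Z %| U.[r])%Z].
  move=> Ur; have [p ltp p_pr] := prime_above `|D|.
  exists p, r; rewrite p_pr Ur dvdz0; split=> //.
  by rewrite dvdzE; apply/negP => /dvdn_leq; rewrite absz_gt0 D0 leqNgt ltp => /(_ isT).
have [c0|c0] := eqVneq U`_0 0; first by apply: (root_ok 0); rewrite horner_coef0.
(* [V] vanishes where U takes the value c or -c. Avoiding its roots excludes 1 + D w = 1 and 1 + D w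
   = -1, which have no prime factor. *)
set c := U`_0 in c0; pose E := D * c; pose V := U ^+ 2 - (c ^+ 2)%:P.
have V0 : V != 0.
  rewrite subr_eq0; apply/eqP => /(congr1 (fun p : {poly int} => size p)).
  have U0 : U != 0 by rewrite -size_poly_gt0 ltnW.
  rewrite /= expr2 size_mul // => eqs; have := size_polyC_leq1 (c ^+ 2); rewrite expr2 -eqs.
  by have /(_ _ sU) : forall n, (1 < n)%N -> ((n + n).-1 <= 1)%N -> False by lia.
have [t Vt] : exists t : nat, V.[E * t%:Z] != 0.
  apply: contrapT => none.
  have uniqn : uniq [seq E * i%:Z | i <- iota 0 (size V)].
    by rewrite map_inj_uniq ?iota_uniq // => i j /(mulfI (mulf_neq0 D0 c0)) [].
  have /(max_poly_roots V0)/(_ uniqn) : all (root V) [seq E * i%:Z | i <- iota 0 (size V)].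
    apply/allP => _ /mapP[i _ ->]; apply/negPn/negP => nr.
    by apply: none; exists i.
  by rewrite size_map size_iota ltnn.
have [W UE] : exists w, U.[E * t%:Z] = c * (1 + D * w).
  exists (t%:Z * (\sum_(i < (size U).-1) U`_i.+1 * (E * t%:Z) ^+ i)).
  rewrite horner_coef -(prednK (ltnW sU)) big_ord_recl expr0 mulr1 mulrDr mulr1 -/c.
  congr (_ + _); rewrite !mulrA [c * D]mulrC mulr_sumr; apply: eq_bigr => i _.
  by rewrite exprS mulrCA.
have [n0|n0] := eqVneq (1 + D * W) 0; first by apply: (root_ok (E * t%:Z)); rewrite UE n0 mulr0.
set n := 1 + D * W in UE n0.
have n1 : `|n|%N != 1%N.
  apply: contraNneq Vt => n1.
  rewrite /V hornerD hornerN horner_exp hornerC UE exprMn.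
  suff -> : n ^+ 2 = 1 by rewrite mulr1 subrr.
  by have [->|->] : n = 1 \/ n = -1 by lia.
exists (pdiv `|n|%N), (E * t%:Z).
have p_pr : prime (pdiv `|n|%N) by apply: pdiv_prime; lia.
have pdv : ((pdiv `|n|%N)%:Z %| n)%Z by rewrite dvdzE pdiv_dvd.
split=> //; last by rewrite UE dvdz_mull.
apply/negP => pD; move: pdv; rewrite rpredDr ?dvdz_mulr // dvdz1.
by apply/negP; rewrite neq_ltn prime_gt1 ?orbT.
Qed.

(** * Polynomial rings over the integers *)

Definition monomial (R : comNzRingType) K (x : nat -> R) (e : nat -> nat) : R :=
  \prod_(i < K) x i ^+ e i.

(** The properties of the integral polynomial ring in [K] variables on which the proof relies. In
    the spanning clause, signs and repetitions stand for integer coefficients. *)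
Record free_ring (R : idomainType) (K : nat) (x : nat -> R) : Prop := FreeRing {
  free_ring_specializes : specializes R;
  free_ring_univ : forall (S : comNzRingType) (y : nat -> S),
    exists phi : {rmorphism R -> S}, forall i, (i < K)%N -> phi (x i) = y i;
  free_ring_span : forall r, exists l : seq (bool * (nat -> nat)),
    r = \sum_(t <- l) (-1) ^+ t.1 * monomial K x t.2;
  free_ring_coef : forall e : nat -> nat, exists c : {additive R -> int},
    forall e', c (monomial K x e') = [forall i : 'I_K, e i == e' i]%:R }.

Lemma free_ring_exists K : exists (R : idomainType) (x : nat -> R), free_ring K x.
Proof.
elim: K => [|K [R [x [spR univ spn coef]]]].
  exists int, (fun=> 0); split=> [|S y|r|e].
  - exact: specializes_int.
  - by exists (intr : {rmorphism int -> S}).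
  - exists (nseq `|r| (r < 0, fun=> 0%N)).
    rewrite big_nseq_cond /= iter_addr_0 /monomial big_ord0 mulr1.
    by rewrite [LHS]intEsign -mulr_natr natz.
  - exists (idfun : {additive int -> int}) => e'; rewrite /monomial big_ord0.
    by rewrite (_ : [forall i, _] = true) //; apply/forallP => -[].
pose x' i : {poly R} := if i == K then 'X else (x i)%:P.
have monE e : monomial K.+1 x' e = (monomial K x e)%:P * 'X^(e K).
  rewrite /monomial big_ord_recr /= /x' eqxx; congr (_ * _).
  by rewrite rmorph_prod; apply: eq_bigr => i _; rewrite ltn_eqF // rmorphXn.
exists {poly R}, x'; split=> [|S y|r|e].
- exact: specializes_poly.
- have [phi phix] := univ S y.
  exists (horner_eval (y K) \o map_poly phi) => i ltiK /=; rewrite /horner_eval /x'.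
  case: eqP => [->|neiK]; first by rewrite map_polyX hornerX.
  by rewrite map_polyC hornerC /= phix //; lia.
- elim/poly_ind: r => [|r c [l ->]]; first by exists nil; rewrite big_nil.
  have [lc ->] := spn c.
  exists ([seq (t.1, fun i => (t.2 i + (i == K))%N) | t <- l] ++
          [seq (t.1, fun i => if i == K then 0%N else t.2 i) | t <- lc]).
  rewrite big_cat !big_map mulr_suml rmorph_sum; congr (_ + _); apply: eq_bigr => t _ /=.
    rewrite -mulrA; congr (_ * _); rewrite !monE eqxx addn1 exprSr mulrA; congr (_%:P * _ * _).
    by apply: eq_bigr => i _; rewrite ltn_eqF // addn0.
  rewrite monE eqxx expr0 mulr1 rmorphM rmorphXn rmorphN1; congr (_ * _%:P).
  by apply: eq_bigr => i _; rewrite ltn_eqF.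
- have [c cE] := coef e.
  exists (c \o coefp (e K)) => e' /=.
  have -> : [forall i : 'I_K.+1, e i == e' i] = (e K == e' K) && [forall i : 'I_K, e i == e' i].
    apply/forallP/andP => [eqe|[eqK /forallP eqe] i]; last first.
      have [ltiK|leKi] := ltnP i K; first exact: (eqe (Ordinal ltiK)).
      by rewrite (_ : i = K :> nat) //; apply/eqP; rewrite eqn_leq -ltnS ltn_ord.
    by split; [apply: (eqe ord_max) | apply/forallP => i; apply: (eqe (widen_ord (leqnSn K) i))].
  rewrite monE coefMXn; case: ltngtP => [_|lt|eq_e] /=; rewrite ?raddf0 //.
    by rewrite coefC subn_eq0 leqNgt lt raddf0.
  by rewrite eq_e subnn coefC eqxx cE.
Qed.

(** * Values of rational polynomials modulo a prime *)

Lemma Fp_intr_eq0 p z : prime p -> (z%:~R == 0 :> 'F_p) = (p%:Z %| z)%Z.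
Proof.
move=> p_pr; rewrite dvdzE (dvdn_pcharf (pchar_Fp p_pr)) [z in LHS]intEsign.
by rewrite rmorphM rmorph_sign /= mulf_eq0 signr_eq0.
Qed.

Section Reduction.
Variables (p : nat) (p_pr : prime p) (r : int).

(* t is the value of u at r modulo p, for u with denominators prime to p. *)
Definition reduces (u : {poly rat}) (t : 'F_p) : Prop :=
  exists (U : {poly int}) (d : int), [/\ ~~ (p%:Z %| d)%Z,
    d%:~R *: u = map_poly intr U & d%:~R * t = U.[r]%:~R].

Lemma reduces_int (U : {poly int}) : reduces (map_poly intr U) U.[r]%:~R.
Proof.
exists U, 1; rewrite scale1r mul1r; split=> //.
by rewrite dvdz1 neq_ltn prime_gt1 ?orbT.
Qed.

Lemma reducesD u v s t : reduces u s -> reduces v t -> reduces (u + v) (s + t).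
Proof.
move=> [U [d [pd uE sE]]] [V [e [pe vE tE]]].
exists (e *: U + d *: V), (d * e); split.
- by rewrite -Fp_intr_eq0 // rmorphM mulf_eq0 !Fp_intr_eq0 // negb_or pd.
- rewrite rmorphD /= !linearZ /= -uE -vE !scalerA scalerDr -!rmorphM /= mulrC.
  by rewrite [e * d]mulrC.
- rewrite hornerD !hornerZ rmorphD !rmorphM /= -sE -tE mulrDr.
  by rewrite [in X in X + _]mulrC -mulrA [_ * s]mulrC !mulrA; congr (_ + _);
    rewrite ?mulrA // mulrC mulrA.
Qed.

Lemma reducesM u v s t : reduces u s -> reduces v t -> reduces (u * v) (s * t).
Proof.
move=> [U [d [pd uE sE]]] [V [e [pe vE tE]]].
exists (U * V), (d * e); split.
- by rewrite -Fp_intr_eq0 // rmorphM mulf_eq0 !Fp_intr_eq0 // negb_or pd.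
- rewrite !rmorphM /= -uE -vE -scalerAl -scalerAr scalerA //.
- by rewrite hornerM !rmorphM /= -sE -tE mulrACA.
Qed.

Lemma reduces_uniq u s t : reduces u s -> reduces u t -> s = t.
Proof.
move=> [U [d [pd uE sE]]] [V [e [pe vE tE]]].
have UV : e *: U = d *: V.
  apply: (@map_inj_poly _ _ (intr : int -> rat)) => //; first exact: intr_inj.
  by rewrite !linearZ /= -uE -vE !scalerA mulrC.
have d0 : d%:~R != 0 :> 'F_p by rewrite Fp_intr_eq0.
have e0 : e%:~R != 0 :> 'F_p by rewrite Fp_intr_eq0.
apply: (mulfI (mulf_neq0 d0 e0)); rewrite [in LHS]mulrAC sE mulrC -rmorphM -mulrA tE -rmorphM.
by rewrite /= -!hornerZ UV.
Qed.

End Reduction.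

(** [D] is a common denominator of the polynomials. *)
Lemma reduces_ex (us : seq {poly rat}) :
  exists2 D : int, D != 0 & forall (p : nat) (r : int), prime p -> ~~ (p%:Z %| D)%Z ->
  forall u, u \in us -> exists t, reduces (p := p) r u t.
Proof.
elim: us => [|u us [D D0 IH]]; first by exists 1.
have [U [a a0 uE]] := rat_poly_scale u.
exists (a * D); first by rewrite mulf_neq0.
move=> p r p_pr paD v; rewrite inE => /predU1P[->|]; last first.
  by apply: IH => //; apply: contra paD; apply: dvdz_mull.
have pa : ~~ (p%:Z %| a)%Z by apply: contra paD; apply: dvdz_mulr.
exists (a%:~R^-1 * U.[r]%:~R), U, a; split=> //.
  by rewrite uE scalerA divff ?scale1r // intr_eq0.
by rewrite mulVKf // Fp_intr_eq0.
Qed.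

(* A primitive element z for the coordinates of a point over the algebraic numbers
   turns the point modulo p into a root modulo p of the minimal polynomial of z. *)
Lemma local_point (R : idomainType) K (x : nat -> R) (rs : seq R) :
    free_ring K x -> (forall n, ~ in_ideal rs n.+1%:R) ->
  exists2 p, prime p &
  exists theta : {rmorphism R -> 'F_p}, forall rho, rho \in rs -> theta rho = 0.
Proof.
move=> [spR univ spn _] nospan.
have [P [PI Pprime Pchar rsP]] := char0_prime (ideal_in_ideal rs) nospan.
have [phi phi0 _] := spR P PI Pprime Pchar 1 (proj1 Pprime).
have {rsP}phi0 rho : rho \in rs -> phi rho = 0 by move=> /in_ideal_mem/rsP/phi0.
have [z _ [ps psE]] := algC_PET [seq phi (x i) | i <- iota 0 K].
have szps : size ps = K.
  by rewrite -(size_map (fun p => (map_poly ratr p).[z])) -psE size_map size_iota.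
(* [eta] lifts [phi] to rational polynomials in a variable standing for [z]; it sends each member of
   [rs] to a multiple of the minimal polynomial of [z]. *)
have [eta etax] := univ _ (fun i => ps`_i).
pose ev : {rmorphism {poly rat} -> algC} := horner_eval z \o map_poly ratr.
have evE rho : ev (eta rho) = phi rho.
  have evx i : (i < K)%N -> ev ps`_i = phi (x i).
    move=> ltiK; rewrite /ev /= /horner_eval.
    have := congr1 (fun s : seq algC => s`_i) psE.
    by rewrite /= (nth_map 0%N) ?size_iota // nth_iota // (nth_map 0) ?szps.
  have [l ->] := spn rho; rewrite !rmorph_sum; apply: eq_bigr => t _.
  rewrite !rmorphM !rmorph_sign; congr (_ * _); rewrite !rmorph_prod.
  by apply: eq_bigr => i _; rewrite !rmorphXn etax // evx.
have [m [_ mmon mroot]] := minCpolyP z.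
have [U [a a0 mE]] := rat_poly_scale m.
(* Both the coordinates and the quotients of the relations by [m] must have denominators prime to
   p. *)
have [D D0 red] := reduces_ex (ps ++ [seq eta rho %/ m | rho <- rs]).
have mz : root (map_poly ratr m : {poly algC}) z by rewrite mroot dvdpp.
have [|//|p [r [p_pr pDa pU]]] := @schur U (a * D).
- have -> : size U = size m.
    rewrite mE size_scale ?invr_eq0 ?intr_eq0 // size_map_poly_id0 //.
    rewrite intr_eq0 lead_coef_eq0; apply: contraTneq mmon => U0.
    by rewrite mE U0 map_polyC scaler0 monicE lead_coef0 eq_sym oner_eq0.
  rewrite ltnNge; apply/negP => sm1; move: mz mmon; rewrite (size1_polyC sm1).
  by rewrite map_polyC rootC fmorph_eq0 => /eqP ->; rewrite monicE lead_coefC eq_sym oner_eq0.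
- by rewrite mulf_neq0.
have pa : ~~ (p%:Z %| a)%Z by apply: contra pDa; apply: dvdz_mulr.
have pD : ~~ (p%:Z %| D)%Z by apply: contra pDa; apply: dvdz_mull.
have {}red := red p r p_pr pD.
have redx i : exists t : 'F_p, (i < K)%N -> reduces r (ps`_i) t.
  have [ltiK|] := ltnP i K; last by exists 0.
  by have [|t] := red ps`_i; [rewrite mem_cat mem_nth ?szps | exists t].
have [y yE] := choice redx.
have [theta thetax] := univ _ y.
have redE rho : reduces r (eta rho) (theta rho).
  have red1 (n : int) : reduces (p := p) r (n%:~R) (n%:~R).
    by have := reduces_int p_pr r n%:P; rewrite map_polyC hornerC /= rmorph_int.
  have [l ->] := spn rho; rewrite !rmorph_sum.
  apply: (big_ind2 (reduces r)) => [|u s v t|t _]; [exact: (red1 0)|exact: reducesD|].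
  rewrite !rmorphM !rmorph_sign; apply: reducesM => //.
    by have := red1 ((-1) ^+ t.1); rewrite !rmorph_sign.
  rewrite !rmorph_prod; apply: (big_ind2 (reduces r)) => [|u s v t'|i _].
  - exact: (red1 1).
  - exact: reducesM.
  rewrite !rmorphXn etax // thetax //.
  elim: (t.2 i) => [|k IHk]; first exact: (red1 1).
  by rewrite !exprS; apply: reducesM => //; apply: yE.
exists p => //; exists theta => rho rho_rs; apply: (reduces_uniq p_pr (redE rho)).
have -> : eta rho = eta rho %/ m * m.
  by rewrite divpK // -mroot; apply/eqP; rewrite -[RHS](phi0 _ rho_rs) -evE.
have [|t redq] := red (eta rho %/ m).
  by rewrite mem_cat; apply/orP; right; apply: map_f.
(* [U] is [a] times [m], and [r] is a root of [U] modulo [p], so [m] reduces to 0. *)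
rewrite -[0](mulr0 t); apply: reducesM => //; exists U, a; split=> //.
  by rewrite mE scalerA divff ?scale1r // intr_eq0.
by rewrite mulr0; apply/esym/eqP; rewrite Fp_intr_eq0.
Qed.

(** * Correctness of the search *)

Section Affine.
Variable R : comNzRingType.
Implicit Types u v a : nat -> R.

Definition letter_map u v a x t :=
  if odd x then v x./2 * (t - a x./2) else u x./2 * t + a x./2.

Definition orbit0 u v a (s : seq nat) : R := foldr (letter_map u v a) 0 s.

Definition stabilizes c l0 u v a : Prop :=
  [/\ forall l, u l * v l = 1, a l0 = 1 &
      forall w, w \in decode (tl c) -> orbit0 u v a (decode w) = 0].

End Affine.

Lemma mem_decode_ltn x c : x \in decode c -> (x < c)%N.
Proof. by move=> xc; have /allP/(_ _ xc) := gtn_decode c. Qed.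

Lemma decode_tl c : decode (tl c) = behead (decode c).
Proof. exact: codeK. Qed.

Lemma mem_word_ltn w c : w \in decode (tl c) -> (w < c)%N.
Proof. by rewrite decode_tl => /mem_behead/mem_decode_ltn. Qed.

Lemma letter_ltn x w c : w \in decode (tl c) -> x \in decode w -> (x./2 < c)%N.
Proof. by move=> /mem_word_ltn + /mem_decode_ltn; lia. Qed.

Lemma digits_ex p n (f : nat -> nat) : (0 < p)%N -> (forall l, f l < p)%N ->
  exists2 e, (e < p ^ n)%N & forall l, (l < n)%N -> digit p e l = f l.
Proof.
move=> p0; elim: n f => [|n IHn] f ltf; first by exists 0%N.
have [e lte eE] := IHn (fun l => f l.+1) (fun l => ltf l.+1).
exists (f 0 + p * e)%N => [|[|l] ltl]; first by rewrite expnS; have := ltf 0%N; nia.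
  by rewrite /digit expn0 divn1 addnC mulnC modnMDl modn_small.
rewrite -eE // /digit expnS divnMA; congr (_ %/ _ %% _)%N.
by rewrite addnC mulnC divnMDl // divn_small ?addn0.
Qed.

Section Solvable.
Variables (c l0 p : nat).
Hypothesis ltl0 : (l0 < c)%N.

Lemma val_Fp_lt (x : 'F_p) : prime p -> (x < p)%N.
Proof. by move=> p_pr; have := ltn_ord x; rewrite [X in (_ < X)%N](Fp_cast p_pr). Qed.

Lemma natr_Fp_val (x : 'F_p) : x%:R = x.
Proof. exact: natr_Zp. Qed.

Section Tables.
Variables (e1 e2 e3 : nat) (u v a : nat -> 'F_p).
Hypothesis p_pr : prime p.
Hypothesis eu : forall l, (l < c)%N -> u l = (digit p e1 l)%:R.
Hypothesis ev : forall l, (l < c)%N -> v l = (digit p e3 l)%:R.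
Hypothesis ea : forall l, (l < c)%N -> a l = (digit p e2 l)%:R.

Lemma word_valueE w : w \in decode (tl c) ->
  orbit0 u v a (decode w) = (word_value p e1 e2 e3 w)%:R.
Proof.
move=> wc; have /allP lab : {subset decode w <= [pred x | (x./2 < c)%N]}.
  by move=> x /(letter_ltn wc).
rewrite /word_value /orbit0; elim: (decode w) lab => //= x s IHs /andP[ltx /IHs ->].
rewrite /letter_map /affine_step; case: odd; last by rewrite natrD natrM eu ?ea.
rewrite natrM natrD ev // ea // natrB; last by rewrite ltnW // ltn_mod prime_gt0.
by rewrite (pchar_Fp_0 p_pr) sub0r.
Qed.
End Tables.

Lemma solvableP : reflect
  (prime p /\ exists u v a : nat -> 'F_p, stabilizes c l0 u v a) (solvable c l0 p).
Proof.
have dvdE : prime p -> forall n, (p %| n)%N = (n%:R == 0 :> 'F_p).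
  by move=> p_pr n; rewrite (dvdn_pcharf (pchar_Fp p_pr)).
apply: (iffP idP) => [|[p_pr [u [v [a [uv a1 wP]]]]]].
  move=> /hasP[e1 _ /hasP[e2 _ /hasP[e3 _ /and4P[p_pr uv /eqP a1 /allP wP]]]].
  split=> //.
  (* Numbers from [c] on occur in no input word; the defaults 1, 1, 0 make u v = 1 hold there
     too. *)
  exists (fun l => if (l < c)%N then (digit p e1 l)%:R else 1).
  exists (fun l => if (l < c)%N then (digit p e3 l)%:R else 1).
  exists (fun l => if (l < c)%N then (digit p e2 l)%:R else 0).
  split=> [l||w wc].
  - case: ifP => ltl; last by rewrite mulr1.
    have /allP/(_ l) := uv; rewrite mem_iota ltl => /(_ isT)/eqP uv1.
    by rewrite -natrM (divn_eq (_ * _) p) uv1 natrD natrM (pchar_Fp_0 p_pr) mulr0 add0r.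
  - by rewrite ltl0 a1.
  - rewrite (@word_valueE e1 e2 e3) // => [|l ->|l ->|l ->] //.
    by apply/eqP; rewrite -dvdE // wP.
have p0 := prime_gt0 p_pr.
have [e1 lt1 eu] := digits_ex c p0 (fun l => val_Fp_lt (u l) p_pr).
have [e2 lt2 ea] := digits_ex c p0 (fun l => val_Fp_lt (a l) p_pr).
have [e3 lt3 ev] := digits_ex c p0 (fun l => val_Fp_lt (v l) p_pr).
apply/hasP; exists e1; first by rewrite mem_iota.
apply/hasP; exists e2; first by rewrite mem_iota.
apply/hasP; exists e3; first by rewrite mem_iota.
apply/and4P; split=> //; last first.
- apply/allP => w wc; rewrite dvdE // -(@word_valueE e1 e2 e3 u v a) ?wP //.
  + by move=> l ltl; rewrite eu // natr_Fp_val.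
  + by move=> l ltl; rewrite ev // natr_Fp_val.
  + by move=> l ltl; rewrite ea // natr_Fp_val.
- by rewrite ea // a1 /= Fp_cast // modn_small // prime_gt1.
apply/allP => l; rewrite mem_iota => /= ltl; rewrite eu // ev //.
have /(congr1 (@nat_of_ord _)) : (u l * v l)%:R = 1%:R :> 'F_p.
  by rewrite natrM !natr_Fp_val uv.
by rewrite !val_Fp_nat // => ->; rewrite modn_small ?prime_gt1.
Qed.

End Solvable.

Section Character.
Variables (R : comNzRingType) (K : nat) (y : nat -> R).

(** Value at the point [y] of the monomial coded by [M]. Primes after the first [K] count as 1, and
    the absent monomial 0 has value 0. *)
Definition chi M : R :=
  if M == 0%N then 0 else \prod_(i < K) y i ^+ logn (nth_prime i) M.

Lemma chi0 : chi 0 = 0. Proof. by []. Qed.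

Lemma chi1 : chi 1 = 1.
Proof. by rewrite /chi big1 // => i _; rewrite logn1. Qed.

Lemma chiM M N : chi (M * N) = chi M * chi N.
Proof.
rewrite /chi muln_eq0; case: eqP => [|/eqP M0]; first by rewrite mul0r.
case: eqP => [|/eqP N0]; first by rewrite mulr0.
rewrite -big_split; apply: eq_bigr => i _.
by rewrite lognM ?lt0n // exprD.
Qed.

Lemma chi_nth_prime i : (i < K)%N -> chi (nth_prime i) = y i.
Proof.
move=> ltiK; rewrite /chi gtn_eqF ?prime_gt0 ?prime_nth_prime //.
rewrite (bigD1 (Ordinal ltiK)) //= logn_prime ?prime_nth_prime // eqxx expr1.
rewrite big1 ?mulr1 // => j; rewrite -val_eqE /= => neji.
by rewrite logn_prime ?prime_nth_prime // (inj_eq nth_prime_inj) (negPf neji) expr0.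
Qed.
End Character.

(** The residue modulo 4 follows the numbering of the four kinds of variables; z_w receives the
    orbit value it stands for. *)
Definition assignment (R : comNzRingType) (u v a : nat -> R) (j : nat) : R :=
  nth 0 [:: u (j %/ 4)%N; v (j %/ 4)%N; a (j %/ 4)%N; orbit0 u v a (decode (j %/ 4))] (j %% 4).

Section Relations.
Variables (R : comNzRingType) (u v a : nat -> R) (L : nat).
Let y := assignment u v a.
Let chi' := chi (4 * L) y.

Lemma chi_var_u l : (l < L)%N -> chi' (var_u l) = u l.
Proof.
move=> ltl; rewrite /chi' chi_nth_prime ?ltn_pmul2l // /y /assignment.
by rewrite mulnC mulnK // modnMl.
Qed.

Lemma divn4 l k : (k < 4)%N -> ((4 * l + k) %/ 4 = l)%N.
Proof. by lia. Qed.
Lemma modn4 l k : (k < 4)%N -> ((4 * l + k) %% 4 = k)%N.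
Proof. by lia. Qed.

Lemma chi_var_v l : (l < L)%N -> chi' (var_v l) = v l.
Proof.
by move=> ltl; rewrite /chi' chi_nth_prime ?/y ?/assignment ?divn4 ?modn4 //; lia.
Qed.

Lemma chi_var_a l : (l < L)%N -> chi' (var_a l) = a l.
Proof.
by move=> ltl; rewrite /chi' chi_nth_prime ?/y ?/assignment ?divn4 ?modn4 //; lia.
Qed.

Lemma chi_var_z w : (w < L)%N -> chi' (var_z w) = orbit0 u v a (decode w).
Proof.
by move=> ltl; rewrite /chi' chi_nth_prime ?/y ?/assignment ?divn4 ?modn4 //; lia.
Qed.

(** A bound on the code of a word thus bounds the indices of all variables in its relation, and
    induction on codes is induction on suffixes. *)
Lemma hd_tl_lt i : (i != 0)%N -> ((hd i)./2 < i)%N /\ (tl i < i)%N.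
Proof.
rewrite -lt0n => i0; have := code_cons i0; have := ltn_expl (hd i) (ltnSn 1).
have : (0 < 2 ^ hd i)%N by rewrite expn_gt0.
by move: (2 ^ hd i)%N (hd i) (tl i) => e h t; nia.
Qed.

Lemma relation_holds c l0 ty i : stabilizes c l0 u v a -> (i < L)%N -> (l0 < L)%N ->
  chi' (rel_p1 c l0 ty i) + chi' (rel_p2 ty i) =
  chi' (rel_n1 ty i) + chi' (rel_n2 ty i).
Proof.
move=> [uv a1 wP] ltiL ltlL; rewrite /rel_p1 /rel_p2 /rel_n1 /rel_n2.
case: ty => [|[|[|ty]]] /=.
- case: eqP => [i0|/eqP i0] /=.
    by rewrite chi_var_z ?(leq_ltn_trans _ ltiL) // !chi0 addr0.
  have [lth ltt] := hd_tl_lt i0.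
  have [lthL lttL] := (ltn_trans lth ltiL, ltn_trans ltt ltiL).
  have orbE : orbit0 u v a (decode i) = letter_map u v a (hd i) (orbit0 u v a (decode (tl i))).
    by rewrite [decode i]decodeE (negPf i0).
  case: ifP => odd_h /=; rewrite /chi' ?chiM -/chi' ?chi_var_u ?chi_var_a ?chi_var_z //;
    rewrite ?chi0 ?addr0 orbE /letter_map odd_h //.
  by rewrite mulrA uv mul1r subrK.
- by rewrite /chi' chiM chi1 !chi0 -/chi' chi_var_u ?chi_var_v // uv.
- by case: hasP => [[w wc /eqP eqw]|_] //; subst w; rewrite chi_var_z ?wP.
- by rewrite chi_var_a // a1 /chi' chi1 chi0.
Qed.
End Relations.

(** * Evaluating a certificate at a point *)

Section Sums.
Variables (R : comNzRingType) (f : nat -> R).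

Lemma sum_indicator B m : f 0%N = 0 -> (m <= B)%N ->
  \sum_(M < B.+1) (m == M :> nat)%:R * f M = f m.
Proof.
move=> f0 lemB; rewrite (bigD1 (Ordinal (lemB : (m < B.+1)%N))) //= eqxx mul1r.
rewrite big1 ?addr0 // => i; rewrite -val_eqE /= eq_sym => /negPf ->.
by rewrite mul0r.
Qed.
End Sums.

Lemma field_leq j t : (field j t <= t)%N.
Proof.
have hd_leq c : (hd c <= c)%N.
  case: (posnP c) => [-> //|/code_cons c0]; rewrite {2}c0.
  by rewrite (leq_trans (ltnW (ltn_expl (hd c) (ltnSn 1)))) // leq_pmulr.
have tl_leq c : (tl c <= c)%N.
  by case: (posnP c) => [-> //|c0]; apply/ltnW/(proj2 (hd_tl_lt _)); rewrite -lt0n.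
rewrite /field; elim: j t => [|j IHj] t; first exact: hd_leq.
by rewrite iterSr (leq_trans (IHj _)).
Qed.

Section Soundness.
Variables (R : comNzRingType) (u v a : nat -> R) (c l0 k : nat).
Hypotheses (stab : stabilizes c l0 u v a) (ltl0 : (l0 < c)%N).
(** Indices of relations listed in the certificate [k] are below [k], and [l0] is below [c], so
    [c + k] variables of each kind suffice. *)
Let f := chi (4 * (c + k)) (assignment u v a).

Lemma item_sum_pos t B : (item_bound c l0 t <= B)%N ->
  \sum_(M < B.+1) (item_pos c l0 t M)%:R * f M =
  f (field 1 t) * (f (rel_p1 c l0 (field 2 t) (field 3 t)) + f (rel_p2 (field 2 t) (field 3 t))).
Proof.
rewrite /item_bound !mulnDr => leB.
under eq_bigr do rewrite natrD mulrDl.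
by rewrite big_split !sum_indicator ?chi0 ?mulrDr /f ?chiM //; lia.
Qed.

Lemma item_sum_neg t B : (item_bound c l0 t <= B)%N ->
  \sum_(M < B.+1) (item_neg t M)%:R * f M =
  f (field 1 t) * (f (rel_n1 (field 2 t) (field 3 t)) + f (rel_n2 (field 2 t) (field 3 t))).
Proof.
rewrite /item_bound !mulnDr => leB.
under eq_bigr do rewrite natrD mulrDl.
by rewrite big_split !sum_indicator ?chi0 ?mulrDr /f ?chiM //; lia.
Qed.

Lemma coef_sum B : (coef_bound c l0 k <= B)%N ->
  \sum_(M < B.+1) (coef_pos c l0 k M)%:R * f M =
  \sum_(M < B.+1) (coef_neg c l0 k M)%:R * f M.
Proof.
rewrite /coef_bound /coef_pos /coef_neg.
have /allP : {subset decode k <= [pred t | (t < k)%N]} by move=> t /mem_decode_ltn.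
elim: (decode k) => [|t s IHs] /=; first by [].
case/andP=> ltt /IHs{}IHs leB.
under eq_bigr do rewrite natrD mulrDl.
under [RHS]eq_bigr do rewrite natrD mulrDl.
rewrite !big_split IHs; last by lia.
congr (_ + _); have leB1 : (item_bound c l0 t <= B)%N by lia.
have rel := @relation_holds _ u v a (c + k) c l0 (field 2 t) (field 3 t) stab.
rewrite -/f in rel.
have {}rel := rel (leq_ltn_trans (field_leq 3 t) (ltn_addl c ltt)) (ltn_addr k ltl0).
by case: odd; rewrite item_sum_pos // item_sum_neg // rel.
Qed.

(** Evaluation at the point gives equal sums over all [M]. The terms with [M] > 1 agree by the
    certificate and [M] = 0 has value 0, which leaves the constants. *)
Lemma certificate_sound : certificate c l0 k ->
  (coef_pos c l0 k 1)%:R = (coef_neg c l0 k 1)%:R :> R.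
Proof.
case/andP=> /allP cancel _; set B := (coef_bound c l0 k).+1.
have := coef_sum (leqnSn _ : (_ <= B)%N).
have lt1 : (1 < B.+1)%N by [].
rewrite (bigD1 (Ordinal lt1)) //= [in RHS](bigD1 (Ordinal lt1)) //= /f chi1 !mulr1.
rewrite (eq_bigr (fun M : 'I_B.+1 =>
  (coef_neg c l0 k M)%:R * chi (4 * (c + k)) (assignment u v a) M)).
  exact: addIr.
move=> [[|[|M]] /= ltM] neM; rewrite ?chi0 ?mulr0 //.
have inM : M.+2 \in iota 0 (coef_bound c l0 k).+2 by rewrite mem_iota.
by have /orP[//|/eqP ->] := cancel _ inM.
Qed.
End Soundness.

(** * From an integer in the ideal to a certificate *)

Section Completeness.
Variables (c l0 : nat).
Hypothesis ltl0 : (l0 < c)%N.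
Variables (R : idomainType) (x : nat -> R).
Let K := (4 * c)%N.
Hypothesis frx : free_ring K x.

(** Finitely many relations are enough, because the input words, their suffixes and their letters
    all have codes or labels below [c]. *)
Definition relators : seq (nat * nat) :=
  [seq (0%N, i) | i <- iota 0 c] ++ [seq (1%N, i) | i <- iota 0 c] ++
  [seq (2%N, i) | i <- decode (tl c)] ++ [:: (3%N, 0%N)].

Definition relator (S : comNzRingType) (y : nat -> S) (r : nat * nat) : S :=
  chi K y (rel_p1 c l0 r.1 r.2) + chi K y (rel_p2 r.1 r.2)
  - (chi K y (rel_n1 r.1 r.2) + chi K y (rel_n2 r.1 r.2)).

Lemma stabilizes_of_relators (S : comNzRingType) (y : nat -> S) :
  (forall r, r \in relators -> relator y r = 0) ->
  exists u v a : nat -> S, stabilizes c l0 u v a.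
Proof.
move=> rel0; have {rel0}rel ty i : (ty, i) \in relators ->
    chi K y (rel_p1 c l0 ty i) + chi K y (rel_p2 ty i) =
    chi K y (rel_n1 ty i) + chi K y (rel_n2 ty i).
  by move=> /rel0/eqP; rewrite subr_eq0 => /eqP.
have mem0 i : (i < c)%N -> (0%N, i) \in relators.
  by move=> lti; rewrite mem_cat map_f // mem_iota.
have mem1 i : (i < c)%N -> (1%N, i) \in relators.
  by move=> lti; rewrite !mem_cat (map_f (pair 1%N)) ?orbT // mem_iota.
have mem2 i : i \in decode (tl c) -> (2%N, i) \in relators.
  by move=> lti; rewrite !mem_cat (map_f (pair 2%N)) ?orbT.
have mem3 : (3%N, 0%N) \in relators by rewrite !mem_cat inE eqxx !orbT.
have yu l : (l < c)%N -> chi K y (var_u l) = y (4 * l)%N.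
  by move=> ltl; rewrite chi_nth_prime // /K; lia.
have yv l : (l < c)%N -> chi K y (var_v l) = y (4 * l + 1)%N.
  by move=> ltl; rewrite chi_nth_prime // /K; lia.
have ya l : (l < c)%N -> chi K y (var_a l) = y (4 * l + 2)%N.
  by move=> ltl; rewrite chi_nth_prime // /K; lia.
have yz l : (l < c)%N -> chi K y (var_z l) = y (4 * l + 3)%N.
  by move=> ltl; rewrite chi_nth_prime // /K; lia.
pose u l := if (l < c)%N then y (4 * l)%N else 1.
pose v l := if (l < c)%N then y (4 * l + 1)%N else 1.
pose a l := if (l < c)%N then y (4 * l + 2)%N else 0.
have uv l : u l * v l = 1.
  rewrite /u /v; case: ifP => ltl; last by rewrite mulr1.
  have := rel _ _ (mem1 _ ltl); rewrite /rel_p1 /rel_p2 /rel_n1 /rel_n2 /=.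
  by rewrite chiM chi1 !chi0 !addr0 yu ?yv.
(* By induction on the code, the relations of type 0 force each z to be the orbit value. *)
have zE w : (w < c)%N -> y (4 * w + 3)%N = orbit0 u v a (decode w).
  have [n] := ubnP w; elim: n w => // n IHn w ltwn ltw.
  have := rel _ _ (mem0 _ ltw); rewrite /rel_p1 /rel_p2 /rel_n1 /rel_n2 /=.
  rewrite [decode w]decodeE; case: (eqVneq w 0%N) => [w0|w0] /=.
    by rewrite !chi0 !addr0 yz ?(leq_ltn_trans _ ltw) // w0.
  have [lth ltt] := hd_tl_lt w0.
  have [lthL lttL] := (ltn_trans lth ltw, ltn_trans ltt ltw).
  rewrite /orbit0 /= -/(orbit0 _ _ _ _) -IHn //; last exact: leq_trans ltt ltwn.
  rewrite /letter_map; case: ifP => odd_h; rewrite /= ?chiM ?chi0 ?addr0 yu // ya // !yz //.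
    move=> <-; rewrite /a lthL addrK mulrA; have := uv (hd w)./2.
    by rewrite {1}/u lthL mulrC => ->; rewrite mul1r.
  by rewrite /u /a lthL => ->.
exists u, v, a; split=> // [|w wc].
  have := rel _ _ mem3; rewrite /rel_p1 /rel_p2 /rel_n1 /rel_n2 /=.
  by rewrite chi1 !chi0 !addr0 ya // /a ltl0.
have ltw := mem_word_ltn wc; rewrite -zE //.
have := rel _ _ (mem2 _ wc); rewrite /rel_p1 /rel_p2 /rel_n1 /rel_n2 /=.
case: hasP => [_|]; last by case; exists w.
by rewrite !chi0 !addr0 yz.
Qed.

(** The integers that code a monomial in the [K] variables faithfully; [chi] forgets all other prime
    factors. *)
Definition smooth N := N = 0%N \/ exists e : nat -> nat, N = (\prod_(i < K) nth_prime i ^ e i)%N.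

Lemma prod_nth_prime_gt0 (e : nat -> nat) : (0 < \prod_(i < K) nth_prime i ^ e i)%N.
Proof. by apply: prodn_gt0 => i; rewrite expn_gt0 prime_gt0 ?prime_nth_prime. Qed.

Lemma logn_prod_nth_prime (e : nat -> nat) j : (j < K)%N ->
  logn (nth_prime j) (\prod_(i < K) nth_prime i ^ e i) = e j.
Proof.
move=> ltj; rewrite (bigD1 (Ordinal ltj)) //= lognM; last first.
- by apply: prodn_gt0 => i; rewrite expn_gt0 prime_gt0 ?prime_nth_prime.
- by rewrite expn_gt0 prime_gt0 ?prime_nth_prime.
rewrite pfactorK ?prime_nth_prime // logn_coprime ?addn0 //.
rewrite coprime_sym; elim/big_ind: _ => [|m n cm cn|i].
- exact: coprime1n.
- by rewrite coprimeMl cm.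
- rewrite -val_eqE /= => neij; apply: coprimeXl.
  rewrite prime_coprime ?prime_nth_prime // dvdn_prime2 ?prime_nth_prime //.
  by rewrite (inj_eq nth_prime_inj).
Qed.

Lemma smooth_nth_prime i : (i < K)%N -> smooth (nth_prime i).
Proof.
move=> lti; right; exists (fun j => (j == i) : nat).
rewrite (bigD1 (Ordinal lti)) //= eqxx expn1 big1 ?muln1 // => j.
by rewrite -val_eqE /= => /negPf ->.
Qed.

Lemma smooth1 : smooth 1.
Proof. by right; exists (fun=> 0%N); rewrite big1. Qed.

Lemma smoothM M N : smooth M -> smooth N -> smooth (M * N)%N.
Proof.
move=> [->|[e ->]] [->|[e' ->]]; rewrite ?muln0 ?mul0n; [by left..|].
right; exists (fun i => (e i + e' i)%N); rewrite -big_split.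
by apply: eq_bigr => i _; rewrite expnD.
Qed.

Lemma smooth_relator r : r \in relators ->
  [/\ smooth (rel_p1 c l0 r.1 r.2), smooth (rel_p2 r.1 r.2),
      smooth (rel_n1 r.1 r.2) & smooth (rel_n2 r.1 r.2)].
Proof.
have s0 : smooth 0 by left.
have s1 := smooth1.
have su l : (l < c)%N -> smooth (var_u l) by move=> ?; apply: smooth_nth_prime; rewrite /K; lia.
have sv l : (l < c)%N -> smooth (var_v l) by move=> ?; apply: smooth_nth_prime; rewrite /K; lia.
have sa l : (l < c)%N -> smooth (var_a l) by move=> ?; apply: smooth_nth_prime; rewrite /K; lia.
have sz l : (l < c)%N -> smooth (var_z l) by move=> ?; apply: smooth_nth_prime; rewrite /K; lia.
rewrite /rel_p1 /rel_p2 /rel_n1 /rel_n2 !mem_cat inE.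
move=> /or4P[/mapP[i + ->]|/mapP[i + ->]|/mapP[i + ->]|/eqP ->] /=.
- rewrite mem_iota /= => lti; case: (eqVneq i 0%N) => [i0|i0] /=.
    by split=> //; apply: sz; apply: leq_ltn_trans lti.
  have [lth ltt] := hd_tl_lt i0; have [? ?] := (ltn_trans lth lti, ltn_trans ltt lti).
  by case: odd; split=> /=; auto; apply: smoothM; auto.
- by rewrite mem_iota /= => lti; split=> //; apply: smoothM; auto.
- by move=> ic; split=> //; case: ifP => // _; apply/sz/mem_word_ltn.
- by split; auto.
Qed.

(* For M not smooth no smooth monomial equals M, and the zero functional will do. *)
Lemma coef_functional M : (0 < M)%N ->
  exists f : {additive R -> int}, forall N, smooth N -> f (chi K x N) = (N == M)%:R.
Proof.
move=> M0; have [[M00|[e ME]]|nsM] := pselect (smooth M); first by rewrite M00 in M0.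
  have [f fE] := free_ring_coef frx e; exists f => N [->|[e' NE]].
    by rewrite chi0 raddf0 ltn_eqF.
  have N0 : (0 < N)%N by rewrite NE prod_nth_prime_gt0.
  rewrite /chi gtn_eqF // -/(monomial K x (fun i => logn (nth_prime i) N)) fE.
  congr (nat_of_bool _)%:R; apply/forallP/eqP => [eqe|eqNM i].
    rewrite NE ME; apply: eq_bigr => i _.
    by rewrite (eqP (eqe i)) NE logn_prod_nth_prime.
  by rewrite eqNM ME logn_prod_nth_prime.
exists (\0 : {additive R -> int}) => N sN /=.
by case: eqP => // eqNM; rewrite eqNM in sN.
Qed.

Definition cert_sum (T : seq (bool * nat * (nat * nat))) : R :=
  \sum_(t <- T) (-1) ^+ t.1.1 * (chi K x t.1.2 * relator x t.2).

(** Expanding each cofactor into signed monomials leaves signed monomial multiples of relators, the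
    items of a certificate. *)
Lemma span_cert z : in_ideal [seq relator x r | r <- relators] z ->
  exists2 T, z = cert_sum T & forall t, t \in T -> smooth t.1.2 /\ t.2 \in relators.
Proof.
move=> [g ->]; rewrite size_map; elim/big_ind: _ => [|z1 z2 [T1 -> ok1] [T2 -> ok2]|i _].
- by exists nil; rewrite // /cert_sum big_nil.
- exists (T1 ++ T2); first by rewrite /cert_sum big_cat.
  by move=> t; rewrite mem_cat => /orP[/ok1|/ok2].
have [l ->] := free_ring_span frx (g i).
rewrite (nth_map (0%N, 0%N)) //.
exists [seq (t.1, (\prod_(j < K) nth_prime j ^ t.2 j)%N, nth (0%N, 0%N) relators i)
       | t : bool * (nat -> nat) <- l].
  rewrite /cert_sum big_map mulr_suml; apply: eq_bigr => t _; rewrite -mulrA /=.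
  congr (_ * (_ * _)); rewrite /chi gtn_eqF ?prod_nth_prime_gt0 //.
  by apply: eq_bigr => j _; rewrite logn_prod_nth_prime.
by move=> _ /mapP[t _ ->] /=; split; [right; exists t.2 | apply: mem_nth].
Qed.

Lemma field_code j s : field j (code s) = nth 0%N s j.
Proof. by rewrite /field /hd decode_iter_tl codeK -nth0 nth_drop addn0. Qed.

Definition item_code (t : bool * nat * (nat * nat)) : nat :=
  code [:: nat_of_bool t.1.1; t.1.2; t.2.1; t.2.2].
Arguments item_code : simpl never.

Definition cert_code (T : seq (bool * nat * (nat * nat))) : nat :=
  code [seq item_code t | t <- T].

(** Links the ring to the procedure: the functional extracting the coefficient of [M] yields the
    difference of the two counts. *)
Lemma cert_sum_coef (f : {additive R -> int}) M T :
  (forall N, smooth N -> f (chi K x N) = (N == M)%:R) ->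
  (forall t, t \in T -> smooth t.1.2 /\ t.2 \in relators) ->
  f (cert_sum T) = (coef_pos c l0 (cert_code T) M)%:Z - (coef_neg c l0 (cert_code T) M)%:Z.
Proof.
move=> fE; rewrite /cert_sum /cert_code /coef_pos /coef_neg codeK.
elim: T => [|[[s m] r] T IHT] okT; first by rewrite big_nil raddf0.
rewrite big_cons raddfD /= {}IHT => [|t tT]; last by apply: okT; rewrite inE tT orbT.
have [/= sm /smooth_relator[sp1 sp2 sn1 sn2]] := okT _ (mem_head _ _).
rewrite /item_pos /item_neg /item_code !field_code /= oddb.
have relE : chi K x m * relator x r =
    chi K x (m * rel_p1 c l0 r.1 r.2) + chi K x (m * rel_p2 r.1 r.2) -
    (chi K x (m * rel_n1 r.1 r.2) + chi K x (m * rel_n2 r.1 r.2)).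
  by rewrite /relator mulrBr !mulrDr -!chiM.
have fd : f (chi K x (m * rel_p1 c l0 r.1 r.2) + chi K x (m * rel_p2 r.1 r.2) -
    (chi K x (m * rel_n1 r.1 r.2) + chi K x (m * rel_n2 r.1 r.2))) =
  (m * rel_p1 c l0 r.1 r.2 == M)%:R + (m * rel_p2 r.1 r.2 == M)%:R
  - ((m * rel_n1 r.1 r.2 == M)%:R + (m * rel_n2 r.1 r.2 == M)%:R).
  by rewrite raddfB !raddfD !fE //; apply: smoothM.
clear okT; rewrite relE mulr_sign; set P := foldr _ _ _; set N := foldr _ _ _; move: P N => P N.
by case: s; rewrite ?raddfN fd !natz; do 4!move: (nat_of_bool _) => ?; lia.
Qed.

(** With no point over a prime field, [local_point] leaves a positive integer in the ideal;
    comparing coefficients in an expression of it gives the certificate. *)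
Lemma certificate_complete :
  (forall p, prime p -> ~ exists u v a : nat -> 'F_p, stabilizes c l0 u v a) ->
  exists k, certificate c l0 k.
Proof.
move=> nosol; apply: contrapT => nocert.
have [n|p p_pr [theta theta0]] := local_point (rs := [seq relator x r | r <- relators]) frx.
  move=> /span_cert[T TE okT]; apply: nocert; exists (cert_code T).
  have coefE M : (0 < M)%N -> (n.+1%:R * (1%N == M)%:R : int) =
      (coef_pos c l0 (cert_code T) M)%:Z - (coef_neg c l0 (cert_code T) M)%:Z.
    move=> M0; have [f fE] := coef_functional M0.
    by rewrite -(cert_sum_coef fE okT) -TE raddfMn -(chi1 K x) fE ?mulr_natl //; apply: smooth1.
  apply/andP; split; last first.
    by apply/negP => /eqP eq1; have := coefE 1%N isT; rewrite eq1 subrr mulr1 natz.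
  apply/allP => -[|[|M]] _ //=; have := coefE M.+2 isT.
  by rewrite mulr0 => /esym/eqP; rewrite subr_eq0 eqz_nat.
apply: (nosol p p_pr); apply: (@stabilizes_of_relators _ (theta \o x)) => r r_in.
have chi_theta M : theta (chi K x M) = chi K (theta \o x) M.
  rewrite /chi; case: eqP => _; first exact: rmorph0.
  by rewrite rmorph_prod; apply: eq_bigr => i _; rewrite rmorphXn.
rewrite /relator -!chi_theta -!rmorphD -rmorphB; apply: theta0.
exact: (map_f (relator x)).
Qed.
End Completeness.

(** Excluded middle on the existence of a point ensures that the search stops without telling which
    alternative stops it. *)
Lemma conclusive_exists c l0 : exists k, conclusive c l0 k.
Proof.
have [lecl|ltlc] := leqP c l0; first by exists 0%N; rewrite /conclusive lecl.
have [[p sol]|nosol] := pselect (exists p, solvable c l0 p).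
  exists p.+1; apply/or3P/Or32; apply/hasP; exists p => //.
  by rewrite mem_iota /= add0n ltnSn.
have [R [x frx]] := free_ring_exists (4 * c).
have [|k certk] := certificate_complete ltlc frx; last by exists k; apply/or3P/Or33.
by move=> p p_pr sol; apply: nosol; exists p; apply/(solvableP p ltlc).
Qed.

Lemma decideP c l0 : (l0 < c)%N ->
  reflect (exists2 p, prime p & exists u v a : nat -> 'F_p, stabilizes c l0 u v a)
          (decide conclusive_exists c l0).
Proof.
move=> ltl0; apply: (iffP hasP) => [[p _ /(solvableP _ ltl0)[p_pr sol]]|[p p_pr sol]].
  by exists p.
rewrite /search; case: ex_minnP => k /or3P[lecl|/hasP[q ltq solq]|certk] _.
- by rewrite leqNgt ltl0 in lecl.
- by exists q => //; move: ltq; rewrite !mem_iota; lia.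
exists p; last exact/solvableP.
have [u [v [a stab]]] := sol; have := certificate_sound stab ltl0 certk.
have /andP[_] := certk; move: (coef_pos _ _ _ _) (coef_neg _ _ _ _) => m n nemn eqmn.
have dvd0 k' : k'%:R = 0 :> 'F_p -> (p %| k')%N by rewrite (dvdn_pcharf (pchar_Fp p_pr)) => ->.
(* The two counts differ but agree modulo [p], so [p] divides a nonzero difference and is at most
   the larger count. *)
have bound k1 k2 : (k1 < k2)%N -> k1%:R = k2%:R :> 'F_p -> (p <= k2)%N.
  move=> lt12 eq12; rewrite (leq_trans _ (leq_subr k1 k2)) // dvdn_leq ?subn_gt0 //.
  by apply: dvd0; rewrite natrB ?(ltnW lt12) // eq12 subrr.
rewrite mem_iota /= add0n ltnS -addnA; apply: leq_trans (leq_addl _ _).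
case: (ltngtP m n) => [lt|lt|eq]; last by rewrite eq eqxx in nemn.
  by apply: leq_trans (bound _ _ lt eqmn) (leq_addl _ _).
by apply: leq_trans (bound _ _ lt (esym eqmn)) (leq_addr _ _).
Qed.

Local Close Scope ring_scope.
Local Open Scope group_scope.

(** * Supersolvable quotients and affine groups *)

(** The image of T :&: U in a chief factor U / V is trivial or everything. In the first case U / V
    is a quotient of U / (T :&: U), which embeds in G / T; in the second it is a quotient of T :&:
    U. *)
Lemma supersolvable_cyclic_by_cyclic (gT : finGroupType) (G T : {group gT}) :
  T <| G -> cyclic T -> cyclic (G / T) -> supersolvable G.
Proof.
move=> nsTG cycT cycGT V U /andP[/maxgroupP[/andP[ltVU nVG] maxV] nsUG].
have [sVU sUG] := (proper_sub ltVU, normal_sub nsUG).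
have nsVG : V <| G by rewrite /normal (subset_trans sVU).
have nsVU : V <| U by apply: normalS nsVG.
pose W := (T :&: U)%G.
have nsWG : W <| G by apply: normalI.
have nVW : W \subset 'N(V) := subset_trans (normal_sub nsWG) nVG.
have sWU : W \subset U by apply: subsetIr.
have sVWU : V <*> W \subset U by rewrite join_subG sVU.
have [VWU|ltVWU] := eqVproper sVWU; last first.
  have VWV : V <*> W = V.
    apply: (maxV (V <*> W)%G); last exact: joing_subl.
    by rewrite ltVWU normsY // normal_norm.
  have sWV : W \subset V by rewrite -VWV joing_subr.
  have nsWU : W <| U by apply: normalS nsWG.
  have cycUW : cyclic (U / W).
    have nTU : U \subset 'N(T) := subset_trans sUG (normal_norm nsTG).
    rewrite (isog_cyclic (second_isog nTU)).
    by apply: cyclicS cycGT; apply: quotientS.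
  by rewrite -(isog_cyclic (third_isog sWV nsWU nsVU)) quotient_cyclic.
rewrite -VWU joingC quotientYidr // quotient_cyclic //.
by apply: cyclicS cycT; apply: subsetIl.
Qed.

(* x |-> (t |-> chi x * t + alpha x) is an action of Q on 'F_p by affine maps. *)
Definition affine_cocycle (Q : finGroupType) p (chi alpha : Q -> 'F_p) : Prop :=
  [/\ forall x, chi x != 0%R, forall x y, chi (x * y) = (chi x * chi y)%R &
      forall x y, alpha (x * y) = (alpha x + chi x * alpha y)%R].

Lemma affine_cocycle1 (Q : finGroupType) p (chi alpha : Q -> 'F_p) :
  affine_cocycle chi alpha -> chi 1 = 1%R /\ alpha 1 = 0%R.
Proof.
case=> chi0 chiM alphaM; have chi1 : chi 1 = 1%R.
  by apply: (mulfI (chi0 1)); rewrite -chiM mulg1 mulr1.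
split=> //; apply: (addrI (alpha 1)); rewrite addr0.
by rewrite -{3}[1]mulg1 alphaM chi1 mul1r.
Qed.

(** On the kernel of [chi], [alpha] is an injective homomorphism to the additive group of ['F_p];
    the quotient embeds in the unit group. Both groups are cyclic. *)
Lemma supersolvable_affine (Q : finGroupType) p (chi alpha : Q -> 'F_p) :
  affine_cocycle chi alpha -> (forall x, chi x = 1%R -> alpha x = 0%R -> x = 1) ->
  supersolvable [set: Q]%G.
Proof.
move=> aff inj; have [chi1 alpha1] := affine_cocycle1 aff.
have [chi0 chiM alphaM] := aff.
have chiU x : chi x \is a GRing.unit by rewrite unitfE.
pose f x : {unit 'F_p} := FinRing.unit 'F_p (chiU x).
have fM : {in [set: Q] &, {morph f : x y / x * y}}.
  by move=> x y _ _; apply: val_inj; rewrite /= chiM.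
pose fm := Morphism fM.
have kerP x : (x \in 'ker fm) = (chi x == 1%R).
  rewrite -[RHS]/(val (fm x) == val (1 : {unit 'F_p})) (inj_eq val_inj).
  by apply/kerP/eqP; rewrite ?inE.
apply: (@supersolvable_cyclic_by_cyclic _ _ ('ker fm)%G).
- exact: ker_normal.
- have inj2 x y : chi x = 1%R -> chi y = 1%R -> alpha x = alpha y -> x = y.
    move=> chix chiy eqxy; suff yx : y^-1 * x = 1 by rewrite -[LHS](mulKVg y) yx mulg1.
    apply: inj; first by rewrite chiM chix -{1}chiy -chiM mulVg.
    by rewrite alphaM eqxy -alphaM mulVg.
  have [triv|/trivgPn[z]] := eqVneq ('ker fm)%G 1%G; first by rewrite triv cyclic1.
  rewrite kerP => /eqP chiz z1.
  have alphaz : alpha z != 0%R by apply: contraNneq z1 => az; apply/eqP/inj.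
  have chiX n : chi (z ^+ n) = 1%R.
    by elim: n => // n IHn; rewrite expgS chiM chiz IHn mul1r.
  have alphaX n : alpha (z ^+ n) = (alpha z *+ n)%R.
    by elim: n => // n IHn; rewrite expgS alphaM chiz IHn mul1r mulrS.
  apply/cyclicP; exists z; apply/eqP; rewrite eqEsubset cycle_subG kerP chiz eqxx andbT.
  apply/subsetP => x; rewrite kerP => /eqP chix.
  have -> : x = z ^+ (alpha x / alpha z)%R; last exact: mem_cycle.
  by apply: inj2; rewrite // alphaX -mulr_natr natr_Zp mulrC divfK.
- by rewrite (isog_cyclic (first_isog fm)) field_unit_group_cyclic.
Qed.

(** * Homomorphisms from free groups and density *)

Lemma multiplicative_of_morph (G H : groupType) (f : G -> H) :
  {morph f : x y / x * y} -> exists phi : {multiplicative G -> H}, phi =1 f.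
Proof.
move=> fM; pose m := isMultiplicative.Build G H f fM.
pose phi : {multiplicative G -> H} := HB.pack f m.
by exists phi.
Qed.

Section FreeBasis.
Variables (X : eqType) (F : groupType) (b : X -> F).
Hypothesis freeb : free_basis b.

Lemma multiplicative1 (G H : groupType) (phi : {multiplicative G -> H}) : phi 1 = 1.
Proof. by apply: (mulgI (phi 1)); rewrite -gmulfM !mulg1. Qed.

Lemma multiplicativeV (G H : groupType) (phi : {multiplicative G -> H}) x :
  phi x^-1 = (phi x)^-1.
Proof. by apply: (mulgI (phi x)); rewrite -gmulfM !mulgV multiplicative1. Qed.

(** Uniqueness in the universal property stands in for generation by the basis: [pi] agrees with a
    homomorphism constructed through [M]. *)
Lemma basis_image (Q : finGroupType) (pi : {multiplicative F -> Q}) (M : {group Q}) :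
  (forall x, pi (b x) \in M) -> forall g, pi g \in M.
Proof.
move=> piM g; have [[psi psiE] _] := freeb (fun x => subg M (pi (b x))).
have [|psi' psi'E] := @multiplicative_of_morph F Q (fun g => sgval (psi g)).
  by move=> x y; rewrite gmulfM.
have [_ /(_ pi psi') ->] := freeb (fun x => pi (b x)); rewrite ?psi'E //; first exact: subgP.
by move=> x; rewrite psi'E psiE subgK.
Qed.
End FreeBasis.

Section WordOrbit.
Variables (X : Type) (p : nat) (u v a : X -> 'F_p).

Definition letter_act (l : X * bool) (t : 'F_p) : 'F_p :=
  (if l.2 then v l.1 * (t - a l.1) else u l.1 * t + a l.1)%R.

Definition word_orbit (w : word X) : 'F_p := foldr letter_act 0%R w.
End WordOrbit.

Section Obstruction.
Variables (X : eqType) (F : groupType) (b : X -> F).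
Hypothesis freeb : free_basis b.
Variables (p : nat) (u v a : X -> 'F_p).
Hypothesis uv : forall x, (u x * v x = 1)%R.

Lemma letter_act_inj x : injective (fun t => u x * t + a x)%R.
Proof.
have u0 : (u x != 0)%R by apply/eqP => u0; have /eqP := uv x; rewrite u0 mul0r eq_sym oner_eq0.
by move=> s t /addIr/(mulfI u0).
Qed.

Definition affine_perm x : {perm 'F_p} := perm (@letter_act_inj x).

Lemma affine_permV x t : (affine_perm x)^-1 t = (v x * (t - a x))%R.
Proof.
apply: (@perm_inj _ (affine_perm x)); rewrite permKV permE.
by rewrite mulrA uv mul1r subrK.
Qed.

Lemma affine_group_proof : group_set
  [set s : {perm 'F_p} | [exists c : 'F_p, exists d : 'F_p,
     (c != 0%R) && [forall t, s^-1 t == (c * t + d)%R]]].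
Proof.
apply/group_setP; split=> [|s s'].
  rewrite inE; apply/existsP; exists 1%R; apply/existsP; exists 0%R.
  by rewrite oner_eq0; apply/forallP => t; rewrite invg1 perm1 mul1r addr0.
rewrite !inE => /existsP[c /existsP[d /andP[c0 /forallP sE]]].
move=> /existsP[c' /existsP[d' /andP[c'0 /forallP s'E]]].
apply/existsP; exists (c * c')%R; apply/existsP; exists (c * d' + d)%R.
rewrite mulf_neq0 //; apply/forallP => t.
by rewrite invgM permM (eqP (s'E t)) (eqP (sE _)) mulrDr mulrA addrA.
Qed.
Definition affine_group := Group affine_group_proof.

Lemma affine_groupP s : s \in affine_group ->
  exists2 c : 'F_p, c != 0%R & forall t, s^-1 t = (c * t + (s^-1)%g 0)%R.
Proof.
rewrite inE => /existsP[c /existsP[d /andP[c0 /forallP sE]]]; exists c => // t.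
by rewrite (eqP (sE t)) (eqP (sE 0%R)) mulr0 add0r.
Qed.

Lemma affine_perm_mem x : (affine_perm x)^-1 \in affine_group.
Proof.
rewrite inE; apply/existsP; exists (u x); apply/existsP; exists (a x).
apply/andP; split; last by apply/forallP => t; rewrite invgK permE.
by apply/eqP => u0; have /eqP := uv x; rewrite u0 mul0r eq_sym oner_eq0.
Qed.

(* Permutations compose from left to right, so the basis is sent to the inverses of
   the affine maps for the first letter of a word to act last. *)
Lemma affine_not_dense (ws : seq (word X)) x0 :
  (forall w, w \in ws -> word_orbit u v a w = 0%R) -> a x0 != 0%R ->
  ~ Su_dense (subgroup_gen (fun g => exists2 w, w \in ws & g = eval_word b w)).
Proof.
move=> ws0 a0 /Su_denseP dense.
have [[phi phiE] _] := freeb (fun x => (affine_perm x)^-1).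
have phiA g : phi g \in affine_group.
  by apply: (basis_image freeb) => x; rewrite phiE affine_perm_mem.
have evalE w : (phi (eval_word b w))^-1 0%R = word_orbit u v a w.
  elim: w => [|l w IHw]; first by rewrite /eval_word big_nil multiplicative1 invg1 perm1.
  rewrite /eval_word big_cons -/(eval_word b w) gmulfM invgM permM IHw /=.
  rewrite /letter_act; case: l.2; last by rewrite phiE invgK permE.
  by rewrite multiplicativeV phiE invgK affine_permV.
have Hfix h : subgroup_gen (fun g => exists2 w, w \in ws & g = eval_word b w) h ->
    phi h 0%R = 0%R.
  elim=> [g [w /ws0 w0 ->]||g h' _ IHg _ IHh|g _ IHg].
  - by have := evalE w; rewrite w0 => e0; rewrite -{1}e0 permKV.
  - by rewrite multiplicative1 perm1.
  - by rewrite gmulfM permM IHg IHh.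
  - by rewrite multiplicativeV -{1}IHg permK.
(* [Su_conormal] asks for an epimorphism, so the target is cut down to the image of [phi]. *)
have imG : group_set [set s : {perm 'F_p} | `[< exists g, phi g = s >]].
  apply/group_setP; split=> [|s t]; rewrite !inE; last first.
    move=> /asboolP[g <-] /asboolP[h <-]; apply/asboolP; exists (g * h).
    by rewrite gmulfM.
  by apply/asboolP; exists 1; apply: multiplicative1.
pose G := Group imG.
have phiG g : phi g \in G by rewrite inE; apply/asboolP; exists g.
have [|pi piE] := @multiplicative_of_morph F _ (fun g => subg G (phi g)).
  by move=> x y; rewrite gmulfM; apply: val_inj; rewrite /= !subgK ?groupM.
have chi_ex (q : subg_of G) : exists c : 'F_p, c != 0%R /\
    forall t, (sgval q)^-1 t = (c * t + ((sgval q)^-1)%g 0)%R.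
  have := subgP q; rewrite inE => /asboolP[g eqg].
  by have [c c0 cE] := affine_groupP (phiA g); exists c; rewrite -eqg.
have [chi chiE] := choice chi_ex.
(* Taking the image of 0 under the inverse makes up for composition from left to right and gives the
   cocycle law. *)
pose alpha (q : subg_of G) := (sgval q)^-1 0%R.
have qE (q : subg_of G) t : (sgval q)^-1 t = (chi q * t + alpha q)%R by case: (chiE q).
have qrE (q r : subg_of G) t : (sgval (q * r))^-1 t = (chi q * (chi r * t + alpha r) + alpha q)%R.
  by rewrite /= invgM permM !qE.
have alphaM q r : alpha (q * r) = (alpha q + chi q * alpha r)%R.
  by rewrite {1}/alpha qrE mulr0 add0r addrC.
have aff : affine_cocycle chi alpha.
  split=> [q|q r|//]; first by case: (chiE q).
  have := qrE q r 1%R; rewrite qE alphaM !mulr1 mulrDr -addrA.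
  by rewrite [(_ + alpha q)%R]addrC => /addIr.
have SuN : Su_conormal (fun g => pi g = 1).
  exists (subg_of G), pi; split=> // [q|].
    have := subgP q; rewrite inE => /asboolP[g eqg]; exists g.
    by rewrite piE eqg sgvalK.
  apply: supersolvable_affine aff _ => q chiq alphaq.
  apply: val_inj; apply: invg_inj; apply/permP => t /=.
  by rewrite qE chiq alphaq mul1r addr0 invg1 perm1.
(* Density writes [b x0] as a product of [h] fixing 0 and [n] acting trivially, yet [b x0] moves
   0. *)
have [h [n [/Hfix h0 n1 gE]]] := dense _ SuN (b x0).
have phin : phi n = 1.
  by have := congr1 sgval (piE n); rewrite n1 subgK.
have : phi (b x0) 0%R = 0%R by rewrite gE gmulfM phin mulg1.
rewrite phiE affine_permV sub0r => /eqP; rewrite mulf_eq0 oppr_eq0 (negPf a0) orbF.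
by apply/negP/eqP => v0; have /eqP := uv x0; rewrite v0 mulr0 eq_sym oner_eq0.
Qed.
End Obstruction.

(* The affine action is that on the cosets of K, identified with U. *)
Lemma prime_complement_cocycle (gT : finGroupType) (p : nat) (U K : {group gT}) :
  prime p -> #|U| = p -> U <| [set: gT] -> U * K = [set: gT] -> U :&: K = 1 ->
  exists chi alpha : gT -> 'F_p, [/\ affine_cocycle chi alpha,
    forall k, k \in K -> alpha k = 0%R & exists x, alpha x != 0%R].
Proof.
move=> p_pr oU nsU UK tiUK.
have /cyclicP[g Ug] : cyclic U by rewrite prime_cyclic ?oU.
have og : #[g] = p by rewrite orderE -Ug.
(* Exponents are read in ['F_p] through their natural representatives, so that x |-> g ^+ x
   identifies ['F_p] with [U]. *)
have gX (m n : nat) : (g ^+ m == g ^+ n) = (m%:R == n%:R :> 'F_p)%R.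
  by rewrite eq_expg_mod_order og -(inj_eq val_inj) /= !val_Fp_nat.
have gF n : g ^+ (n%:R : 'F_p)%R = g ^+ n.
  by apply/eqP; rewrite gX natr_Zp.
have gD (x y : 'F_p) : g ^+ (x + y)%R = g ^+ x * g ^+ y.
  by rewrite -expgD -[RHS]gF natrD !natr_Zp.
have gM (x y : 'F_p) : g ^+ (x * y)%R = (g ^+ x) ^+ y.
  by rewrite -expgM -[RHS]gF natrM !natr_Zp.
have g_inj (x y : 'F_p) : g ^+ x = g ^+ y -> x = y.
  by move/eqP; rewrite gX !natr_Zp => /eqP.
have gU (x : gT) : x \in U -> exists n : 'F_p, x = g ^+ n.
  by rewrite Ug => /cycleP[n ->]; exists n%:R%R; rewrite gF.
have memUg n : g ^+ n \in U by rewrite Ug mem_cycle.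
(* [alpha x] is the exponent of the element of [U] lying in the coset of [K] that contains [x]. *)
have alpha_ex (x : gT) : exists n : 'F_p, (g ^+ n)^-1 * x \in K.
  have : x \in U * K by rewrite UK inE.
  by case/mulsgP => y k /gU[n ->] kK ->; exists n; rewrite mulKg.
have [alpha alphaK] := choice alpha_ex.
have alphaE x (n : 'F_p) k : k \in K -> x = g ^+ n * k -> alpha x = n.
  move=> kK xE; apply: g_inj; apply/eqP; rewrite eq_mulVg1.
  have : (g ^+ alpha x)^-1 * g ^+ n \in U :&: K.
    rewrite inE groupM ?groupV ?memUg //= -(groupMr _ kK) -mulgA -xE; exact: alphaK.
  by rewrite tiUK inE.
(* [chi x] is the multiplier by which conjugation by [x] acts on [U]. *)
have chi_ex (x : gT) : exists n : 'F_p, x * g * x^-1 = g ^+ n.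
  apply: gU; have -> : x * g * x^-1 = g ^ x^-1 by rewrite conjgE invgK mulgA.
  by rewrite memJ_norm ?Ug ?cycle_id // -Ug groupV (subsetP (normal_norm nsU)) ?inE.
have [chi chiE] := choice chi_ex.
have chiX x (n : 'F_p) : x * g ^+ n * x^-1 = g ^+ (chi x * n)%R.
  by rewrite gM -chiE -!mulgA; have := conjXg g x^-1 n; rewrite !conjgE !invgK.
have chiM x y : chi (x * y) = (chi x * chi y)%R.
  by apply: g_inj; rewrite -chiX -!chiE invgM !mulgA.
exists chi, alpha; split.
- split=> [x|//|x y].
    apply/eqP => chix; have : g ^ x^-1 == 1 by rewrite conjgE invgK mulgA chiE chix.
    by rewrite conjg_eq1 -order_eq1 og gtn_eqF ?prime_gt1.
  apply: (alphaE _ _ ((g ^+ alpha x)^-1 * x * ((g ^+ alpha y)^-1 * y))).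
    by rewrite groupM.
  have yE : y = g ^+ alpha y * ((g ^+ alpha y)^-1 * y) by rewrite mulVKg.
  have cUU : commute (g ^+ alpha x)^-1 (x * g ^+ alpha y * x^-1).
    by rewrite chiX; apply/commute_sym/commuteV/commute_sym/commuteX2.
  rewrite gD -chiX -[RHS]mulgA.
  have -> : x * g ^+ alpha y * x^-1 * ((g ^+ alpha x)^-1 * x * ((g ^+ alpha y)^-1 * y)) =
      (g ^+ alpha x)^-1 * (x * y).
    by rewrite -[X in _ * X]mulgA [LHS]mulgA -cUU -!mulgA mulKg mulVKg.
  by rewrite mulVKg.
- by move=> k kK; apply: (alphaE _ _ k) => //; rewrite mul1g.
- exists g; rewrite (alphaE g 1%R 1) ?oner_eq0 ?group1 // mulg1.
  by have := gF 1%N; rewrite expg1.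
Qed.

(* N is maximal among the normal subgroups with K N proper. *)
Lemma normal_chief_step (gT : finGroupType) (K : {group gT}) :
  K \proper [set: gT] ->
  exists N U : {group gT}, [/\ chief_factor [set: gT] N U,
    K <*> N \proper [set: gT] & K <*> U = [set: gT]].
Proof.
move=> ltK; pose P (N : {group gT}) := (N <| [set: gT]) && (K <*> N \proper [set: gT]).
have P1 : P 1%G by rewrite /P normal1 joingG1.
have [N /maxgroupP[/andP[nsN ltKN] maxN] _] := maxgroup_exists P1.
pose Q (U : {group gT}) := (N \proper U) && (U <| [set: gT]).
have QT : Q [set: gT]%G.
  by rewrite /Q normal_refl andbT (sub_proper_trans (joing_subr K N)).
have [U /mingroupP[/andP[ltNU nsU] minU] _] := mingroup_exists QT.
exists N, U; split=> //.
  rewrite /chief_factor nsU andbT; apply/maxgroupP; split.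
    by rewrite ltNU normal_norm.
  move=> V /andP[ltVU nV] sNV; have [//|ltNV] := eqVproper sNV.
  have VU : V = U :> {set gT}.
    by apply: minU (proper_sub ltVU); rewrite /Q ltNV /normal subsetT.
  by rewrite VU properxx in ltVU.
have [//|ltKU] := eqVproper (subsetT (K <*> U)).
have := maxN U _ (proper_sub ltNU); rewrite /P nsU ltKU => /(_ isT) eqUN.
by rewrite eqUN properxx in ltNU.
Qed.

Lemma supersolvable_cocycle (gT : finGroupType) (K : {group gT}) :
  supersolvable [set: gT]%G -> K \proper [set: gT] ->
  exists2 p, prime p & exists chi alpha : gT -> 'F_p, [/\ affine_cocycle chi alpha,
    forall k, k \in K -> alpha k = 0%R & exists x, alpha x != 0%R].
Proof.
move=> superG ltK; have [N [U [chiefU ltKN KU]]] := normal_chief_step ltK.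
have cycU := superG _ _ chiefU.
have /andP[/maxgroupP[/andP[ltNU nNG] _] nsU] := chiefU.
have nN (A : {set gT}) : A \subset 'N(N) := subset_trans (subsetT A) nNG.
(* A cyclic chief factor is solvable, hence elementary abelian, hence of prime order. *)
have [_ ntU /is_abelemP[p p_pr abelU]] := minnormal_solvable
  (chief_factor_minnormal chiefU) (subxx _) (abelian_sol (cyclic_abelian cycU)).
have oU := cyclic_abelem_prime abelU cycU ntU.
have KUq : (K / N) <*> (U / N) = [set: coset_of N] by rewrite -quotientY ?nN // KU quotientT.
have nsUq : (U / N)%G <| [set: coset_of N] by rewrite -quotientT quotient_normal.
have nKUq : K / N \subset 'N(U / N) by rewrite (subset_trans (subsetT _)) ?normal_norm.
have UKq : (U / N) * (K / N) = [set: coset_of N].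
  by rewrite -norm_joinEr // joingC.
(* Having prime order, [U / N] meets [K / N] trivially or lies in it; the latter would make K N the
   whole group. *)
have tiUKq : (U / N) :&: (K / N) = 1.
  apply: prime_TIg; rewrite /= ?oU //; apply: contraL ltKN => sUK.
  have KT : K / N = [set: coset_of N].
    by rewrite -KUq; apply/esym/joing_idPl.
  have : [set: gT] \subset N * K by rewrite -quotientSK // KT subsetT.
  rewrite -norm_joinEr ?nN // joingC => sTK.
  by rewrite properE sTK andbF.
have [chi [alpha [[chi0 chiM alphaM] alphaK [y alphay]]]] :=
  prime_complement_cocycle p_pr oU nsUq UKq tiUKq.
have cosetM x y' : coset N (x * y') = coset N x * coset N y'.
  by rewrite morphM // (subsetP (nN [set: gT])) ?inE.
exists p => //; exists (chi \o coset N), (alpha \o coset N); split.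
- by split=> [x|x y'|x y'] /=; rewrite ?cosetM.
- by move=> k kK; apply/alphaK/mem_quotient.
- by have [x _ eqy] := cosetP y; exists x => /=; rewrite -eqy.
Qed.

Lemma not_dense_affine (X : eqType) (F : groupType) (b : X -> F) (ws : seq (word X)) :
  free_basis b ->
  ~ Su_dense (subgroup_gen (fun g => exists2 w, w \in ws & g = eval_word b w)) ->
  exists2 p, prime p & exists (u v a : X -> 'F_p) x0,
    [/\ forall x, (u x * v x = 1)%R, a x0 = 1%R &
        forall w, w \in ws -> word_orbit u v a w = 0%R].
Proof.
move=> freeb; set H := subgroup_gen _ => ndense.
have [Q [pi [g0 [piS superQ g0H]]]] : exists (Q : finGroupType) (pi : {multiplicative F -> Q}) g0,
    [/\ forall q, exists g, pi g = q, supersolvable [set: Q]%G & forall h, H h -> pi h <> pi g0].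
  apply: contrapT => none; apply/ndense/Su_denseP => N [Q [pi [piS piN superQ]]] g.
  apply: contrapT => noh; apply: none; exists Q, pi, g; split=> // h Hh eqhg.
  apply: noh; exists h, (h^-1 * g); split=> //; last by rewrite mulKVg.
  by apply/piN; rewrite gmulfM multiplicativeV eqhg mulVg.
have imK : group_set [set q | `[< exists2 h, H h & pi h = q >]].
  apply/group_setP; split=> [|s t]; rewrite !inE.
    by apply/asboolP; exists 1; [apply: gen_one | apply: multiplicative1].
  move=> /asboolP[h Hh <-] /asboolP[h' Hh' <-]; apply/asboolP.
  by exists (h * h'); [apply: gen_mul | rewrite gmulfM].
pose K := Group imK.
have ltK : K \proper [set: Q].
  rewrite properE subsetT; apply/subsetPn; exists (pi g0); rewrite ?inE //.
  by apply/asboolP => -[h /g0H].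
have [p p_pr [chi [alpha [aff alphaK [q alphaq]]]]] := supersolvable_cocycle superQ ltK.
have [chi1 alpha1] := affine_cocycle1 aff; have [chi0 chiM alphaM] := aff.
(* The zeros of [alpha] form a subgroup; if it contained the images of the basis it would be all of
   [Q]. *)
have [x0 ax0] : exists x0, alpha (pi (b x0)) != 0%R.
  apply: contrapT => /forallNP none.
  have stab : group_set [set q | alpha q == 0%R].
    apply/group_setP; split=> [|s t]; rewrite !inE ?alpha1 // alphaM => /eqP-> /eqP->.
    by rewrite mulr0 addr0.
  have [g eqg] := piS q; have := @basis_image _ _ _ freeb _ pi (Group stab) _ g.
  rewrite eqg inE (negPf alphaq) => H0; suff: false by []; apply: H0 => x.
  by rewrite inE; apply/negPn/negP/none.
(* Rescaling the coordinate by [c] gives [x0] translation part 1 and leaves the multipliers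
   unchanged. *)
exists p => //; pose c := (alpha (pi (b x0)))^-1%R.
exists (fun x => chi (pi (b x))), (fun x => chi (pi (b x))^-1%g),
  (fun x => c * alpha (pi (b x)))%R, x0.
have alphaV s : alpha s^-1 = (- (chi (s^-1)%g * alpha s))%R.
  by apply/eqP; rewrite -addr_eq0 -alphaM mulVg alpha1.
split=> [x||w ws_w]; first by rewrite -chiM mulgV.
  by rewrite mulVf.
have orbE w' : word_orbit (fun x => chi (pi (b x))) (fun x => chi (pi (b x))^-1%g)
    (fun x => c * alpha (pi (b x)))%R w' = (c * alpha (pi (eval_word b w')))%R.
  elim: w' => [|l w' IHw]; first by rewrite /eval_word big_nil multiplicative1 alpha1 mulr0.
  rewrite /eval_word big_cons -/(eval_word b w') gmulfM alphaM /= IHw /letter_act.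
  case: l.2; last by rewrite mulrDr addrC mulrCA.
  rewrite multiplicativeV alphaV mulrBr mulrDr mulrN addrC.
  by congr (- _ + _)%R; rewrite mulrCA.
rewrite orbE alphaK ?mulr0 // inE; apply/asboolP; exists (eval_word b w) => //.
by apply: gen_in; exists w.
Qed.

(** * The theorem *)

Definition letter_code (X : Type) (lab : X -> nat) (l : X * bool) : nat :=
  ((lab l.1).*2 + l.2)%N.

Lemma odd_letter_code (X : Type) (lab : X -> nat) l : odd (letter_code lab l) = l.2.
Proof. by rewrite oddD odd_double oddb. Qed.

Lemma half_letter_code (X : Type) (lab : X -> nat) l : (letter_code lab l)./2 = lab l.1.
Proof. by rewrite /letter_code addnC half_bit_double. Qed.

Section Input.
Variables (X : eqType) (r : option nat) (ws : seq (word X)) (lab : X -> nat).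
Let c := input_code r lab ws.

Lemma hd_input : hd c = rank_code r.
Proof. by rewrite /hd /c /input_code codeK. Qed.

Lemma decode_tl_input : decode (tl c) = [seq word_code lab w | w <- ws].
Proof. by rewrite decode_tl /c /input_code codeK. Qed.

Lemma decode_word_code w : decode (word_code lab w) = [seq letter_code lab l | l <- w].
Proof. exact: codeK. Qed.

Lemma occurs_input l : occurs c l = (l \in [seq lab x | x <- letters ws]).
Proof.
rewrite /occurs decode_tl_input; apply/hasP/mapP.
  move=> [_ /mapP[w wsw ->] /hasP[y + /eqP <-]]; rewrite decode_word_code => /mapP[l' wl' ->].
  exists l'.1; last exact: half_letter_code.
  by apply/map_f/flattenP; exists w.
move=> [x /mapP[l' /flattenP[w wsw wl'] ->] ->].
exists (word_code lab w); first exact: map_f.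
apply/hasP; exists (letter_code lab l'); first by rewrite decode_word_code map_f.
by rewrite half_letter_code.
Qed.

Lemma label_ltn x : x \in letters ws -> (lab x < c)%N.
Proof.
move=> lx; have : occurs c (lab x) by rewrite occurs_input map_f.
by case/hasP => w wc /hasP[y yw /eqP <-]; apply: letter_ltn yw.
Qed.

Lemma nb_labels_input : {in letters ws &, injective lab} ->
  nb_labels c = size (undup (letters ws)).
Proof.
move=> injl; rewrite /nb_labels -(big_mkord xpredT (fun l => occurs c l : nat)) /index_iota subn0.
rewrite (_ : \sum_(l <- _) _ = count (occurs c) (iota 0 c))%N; last first.
  by elim: (iota 0 c) => [|l s IHs]; rewrite ?big_nil // big_cons IHs.
rewrite -size_filter -(size_map lab).
apply/perm_size/uniq_perm; first by rewrite filter_uniq ?iota_uniq.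
  by rewrite map_inj_in_uniq ?undup_uniq // => x y; rewrite !mem_undup; apply: injl.
move=> l; rewrite mem_filter occurs_input mem_iota /=.
apply/andP/mapP => [[/mapP[x lx ->] _]|[x]]; first by exists x; rewrite ?mem_undup.
by rewrite mem_undup => lx ->; rewrite map_f ?label_ltn.
Qed.

Lemma word_orbit_labels p (u v a : nat -> 'F_p) (u' v' a' : X -> 'F_p) w :
  (forall l, l \in w -> [/\ u' l.1 = u (lab l.1), v' l.1 = v (lab l.1) & a' l.1 = a (lab l.1)]) ->
  word_orbit u' v' a' w = orbit0 u v a (decode (word_code lab w)).
Proof.
rewrite decode_word_code; elim: w => //= l w IHw eqs.
rewrite /orbit0 /= -/(orbit0 _ _ _ _) -IHw => [|l' wl']; last by apply: eqs; rewrite inE wl' orbT.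
rewrite /letter_act /letter_map odd_letter_code half_letter_code.
by have [-> -> ->] := eqs l (mem_head _ _).
Qed.
End Input.

(** Modulo 2, let [x0] act by t |-> t + 1 and the other letters trivially: H falls into the kernel
    of a homomorphism onto a group of order 2. *)
Lemma missing_letter_not_dense (X : eqType) (F : groupType) (b : X -> F)
    (ws : seq (word X)) x0 :
  free_basis b -> x0 \notin letters ws ->
  ~ Su_dense (subgroup_gen (fun g => exists2 w, w \in ws & g = eval_word b w)).
Proof.
move=> freeb nx0.
apply: (@affine_not_dense _ _ _ freeb 2 (fun=> 1%R) (fun=> 1%R) (fun x => (x == x0)%:R%R) _ _ x0).
- by move=> x; rewrite mulr1.
- move=> w wsw.
  have : {in w, forall l, l.1 != x0}.
    move=> l wl; apply: contraNneq nx0 => <-; apply/map_f/flattenP; by exists w.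
  elim: w {wsw} => //= l w IHw nx.
  rewrite IHw => [|l' wl']; last by apply: nx; rewrite inE wl' orbT.
  rewrite /letter_act (negPf (nx l (mem_head _ _))) /=.
  by case: ifP; rewrite mul1r ?subr0 ?addr0.
- by rewrite eqxx oner_eq0.
Qed.

Lemma answer_correct (X : eqType) (F : groupType) (b : X -> F) r (ws : seq (word X))
    (lab : X -> nat) :
  free_basis b -> has_rank X r -> {in letters ws &, injective lab} ->
  Su_dense (subgroup_gen (fun g => exists2 w, w \in ws & g = eval_word b w)) <->
  answer conclusive_exists (input_code r lab ws).
Proof.
move=> freeb rankX injl; set c := input_code r lab ws.
rewrite /answer hd_input nb_labels_input //.
case: r rankX @c => [n [e bije]|infX] c /=; last first.
  have [x0 nx0] := infX (letters ws).
  by split=> // /(missing_letter_not_dense freeb nx0).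
have [e' eK e'K] := bije.
have size_le (s : seq X) : uniq s -> (size s <= n)%N.
  move=> us; have ue : uniq [seq e' x | x <- s].
    by rewrite map_inj_uniq //; apply: can_inj e'K.
  by have := max_card [in [seq e' x | x <- s]]; rewrite (card_uniqP ue) size_map card_ord.
have [all_in|] := pselect (forall x, x \in letters ws); last first.
  move=> /existsNP[x0 /negP nx0]; split=> [/(missing_letter_not_dense freeb nx0) //|].
  case/andP=> /eqP sz _; have /= := size_le (x0 :: undup (letters ws)).
  by rewrite mem_undup nx0 undup_uniq sz ltnn => /(_ isT).
have -> : size (undup (letters ws)) == n.
  rewrite eqn_leq size_le ?undup_uniq //=.
  have ue : uniq (codom e) by rewrite map_inj_uniq ?enum_uniq //; apply: can_inj eK.
  have := uniq_leq_size ue (s2 := undup (letters ws)); rewrite size_codom card_ord.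
  by apply=> x _; rewrite mem_undup.
rewrite /=; split=> [dense|/hasPn nodec].
  apply/negP => /hasP[l]; rewrite mem_iota /= add0n => ltl /andP[].
  rewrite occurs_input => /mapP[x0 _ lE] /(decideP ltl)[p p_pr [u [v [a [uv a1 wP]]]]].
  apply: (@affine_not_dense _ _ _ freeb p (u \o lab) (v \o lab) (a \o lab) _ ws x0 _ _ dense)
    => [x|w wsw|] /=; first exact: uv.
    rewrite (word_orbit_labels (lab := lab) (u := u) (v := v) (a := a)) // wP //.
    by rewrite decode_tl_input map_f.
  by rewrite -lE a1 oner_eq0.
apply: contrapT => /(not_dense_affine freeb)[p p_pr [u [v [a [x0 [uv a1 wP]]]]]].
have ltl : (lab x0 < c)%N by apply: label_ltn.
have := nodec (lab x0); rewrite mem_iota ltl occurs_input map_f // => /(_ isT)/negP; apply.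
apply/(decideP ltl); exists p => //.
(* Every letter occurs, so labels determine letters; a number that is no label is sent to [x0],
   which keeps u v = 1 there. *)
pose inv l := nth x0 (letters ws) (index l [seq lab x | x <- letters ws]).
have invK x : inv (lab x) = x.
  have lx : lab x \in [seq lab x | x <- letters ws] by rewrite map_f.
  have ltx : (index (lab x) [seq lab x | x <- letters ws] < size (letters ws))%N.
    by rewrite -(size_map lab) index_mem.
  by apply: injl; rewrite ?all_in // -(nth_map x0 (lab x0)) // nth_index.
exists (u \o inv), (v \o inv), (a \o inv); split=> [l||w]; rewrite /= ?uv ?invK //.
rewrite decode_tl_input => /mapP[w' wsw' ->].
by rewrite -(@word_orbit_labels _ _ _ _ _ _ u v a) ?wP // => l _ /=; rewrite invK.
Qed.

Local Close Scope group_scope.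

Theorem theorem1 :
  exists2 f : 1.-tuple nat -> nat, recursive f &
    forall (X : eqType) (F : groupType) (b : X -> F),
      free_basis b ->
    forall r : option nat, has_rank X r ->
    forall ws : seq (word X), all (@reduced X) ws ->
    forall lab : X -> nat, {in letters ws &, injective lab} ->
      decides_at f (input_code r lab ws)
        (Su_dense (subgroup_gen
           (fun g => exists2 w, w \in ws & g = eval_word b w))).
Proof.
exists (fun v => answer conclusive_exists (thead v)); first exact: recursive_answer.
move=> X F b freeb r rankX ws _ lab injl; rewrite /decides_at theadE.
have ansP := answer_correct freeb rankX injl.
by split=> [/ansP -> //|nd]; case: (boolP (answer _ _)) => // /ansP.
Qed.
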